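(* For every triangle $T\subseteq\mathbb{R}^2$ and every $\alpha \in [0,1)$, the class $\mathcal{G}(T,\alpha)$ of intersection graphs of $\alpha$-free homothetic copies of $T$ does not admit product structure.
   Context: All graphs and collections are finite. A triangle is a closed, filled, nondegenerate triangle; $\lVert S\rVert$ denotes the area of $S \subseteq \mathbb{R}^2$. $\alpha$-free: a homothetic copy of $S\subseteq\mathbb{R}^2$ is a set obtained from $S$ by positive scaling and translation. For $\alpha \in[0,1]$, a collection $\{S_v\}_{v\in V}$ of homothetic copies of $S$ is $\alpha$-free if for every $v\in V$ we have $\lVert S_v \setminus \bigcup_{u\in V\setminus\{v\}} S_u\rVert \ge \alpha\lVert S_v\rVert$. The intersection graph of the collection has vertex set $V$ and an edge $uv$ (for $u\neq v$) if and only if $S_u\cap S_v\neq\emptyset$. $\mathcal{G}(S,\alpha)$ is the class of all intersection graphs of $\alpha$-free collections of homothetic copies of $S$. Product structure: the strong product $G\boxtimes H$ has vertex set $V(G)\times V(H)$, with distinct vertices $(u,u'),(v,v')$ adjacent iff ($u=v$ or $uv\in E(G)$) and ($u'=v'$ or $u'v'\in E(H)$). A graph class $\mathcal{G}$ admits product structure if there is a constant $t$ such that every $G\in\mathcal{G}$ is a subgraph of $H\boxtimes P$ for some path $P$ and some graph $H$ of treewidth at most $t$. *)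

(* Defs.v *)
From HB Require Import structures.
From mathcomp Require Import all_boot all_order all_algebra.
From mathcomp Require Import all_classical all_reals all_analysis.

Set Implicit Arguments.
Unset Strict Implicit.
Unset Printing Implicit Defensive.

Import Order.TTheory GRing.Theory Num.Theory.
Import numFieldNormedType.Exports.

Local Open Scope classical_set_scope.
Local Open Scope ring_scope.

Record sgraph := SGraph {
  vertex :> finType;
  adj : rel vertex;
  adj_sym : symmetric adj;
  adj_irrefl : irreflexive adj }.

(* [G] is a subgraph of [H] up to isomorphism; not necessarily induced. *)
Definition is_subgraph (G H : sgraph) : Prop :=
  exists2 f : G -> H, injective f & {homo f : x y / adj x y}.

Definition strong_adj (G H : sgraph) : rel (G * H) := fun x y =>
  [&& x != y, (x.1 == y.1) || adj x.1 y.1 & (x.2 == y.2) || adj x.2 y.2].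

Lemma strong_adj_sym (G H : sgraph) : symmetric (@strong_adj G H).
Proof.
move=> x y; rewrite /strong_adj [y == x]eq_sym [y.1 == _]eq_sym.
by rewrite [y.2 == _]eq_sym [adj y.1 _]adj_sym [adj y.2 _]adj_sym.
Qed.

Lemma strong_adj_irrefl (G H : sgraph) : irreflexive (@strong_adj G H).
Proof. by move=> x; rewrite /strong_adj eqxx. Qed.

Definition strong_product (G H : sgraph) : sgraph :=
  SGraph (@strong_adj_sym G H) (@strong_adj_irrefl G H).

Definition path_adj (n : nat) : rel 'I_n := fun i j =>
  (i.+1 == j :> nat) || (j.+1 == i :> nat).

Lemma path_adj_sym (n : nat) : symmetric (@path_adj n).
Proof. by move=> i j; rewrite /path_adj orbC. Qed.

Lemma path_adj_irrefl (n : nat) : irreflexive (@path_adj n).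
Proof. by move=> i; rewrite /path_adj orbb gtn_eqF. Qed.

(* The path with [n.+1] vertices, i.e. of length [n]. *)
Definition path_graph (n : nat) : sgraph :=
  SGraph (@path_adj_sym n.+1) (@path_adj_irrefl n.+1).

(* [A] induces a connected subgraph of [G]; the empty set qualifies. *)
Definition connected_in (G : sgraph) (A : {set G}) : Prop :=
  {in A &, forall x y, connect [rel u v | [&& adj u v, u \in A & v \in A]] x y}.

(* Loops being excluded, a [ucycle] of size at least 3 is a graph cycle, whereas
   one of size 2 is a single edge traversed back and forth. *)
Definition is_tree (G : sgraph) : Prop :=
  [/\ (0 < #|G|)%N, connected_in [set: G]
    & forall c : seq G, ucycle (@adj G) c -> (size c <= 2)%N].

Definition is_tree_decomposition (G T : sgraph) (B : T -> {set G}) : Prop :=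
  [/\ is_tree T,
      forall v : G, exists i : T, v \in B i,
      forall u v : G, adj u v -> exists i : T, (u \in B i) && (v \in B i)
    & forall v : G, connected_in [set i : T | v \in B i]].

(* Truncated to 0 when all bags are empty, i.e. when [G] has no vertex. *)
Definition width (G T : sgraph) (B : T -> {set G}) : nat :=
  (\max_(i : T) #|B i|).-1.

Definition treewidth_at_most (G : sgraph) (t : nat) : Prop :=
  exists (T : sgraph) (B : T -> {set G}),
    is_tree_decomposition B /\ (width B <= t)%N.

Definition admits_product_structure (C : sgraph -> Prop) : Prop :=
  exists t : nat, forall G : sgraph, C G ->
    exists (H : sgraph) (n : nat),
      treewidth_at_most H t /\ is_subgraph G (strong_product H (path_graph n)).

Definition area (R : realType) (S : set (R * R)) : \bar R :=
  (lebesgue_measure \x lebesgue_measure)%E S.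

(* The determinant of (b - a, c - a) is nonzero iff a, b, c are not collinear;
   the set is their convex hull, hence closed and filled. *)
Definition is_triangle (R : realType) (T : set (R * R)) : Prop :=
  exists a b c : R * R,
    (b.1 - a.1) * (c.2 - a.2) - (b.2 - a.2) * (c.1 - a.1) != 0 /\
    T = [set p | exists x y z : R,
           [/\ 0 <= x, 0 <= y, 0 <= z, x + y + z = 1
             & p = x *: a + y *: b + z *: c]].

Definition homothetic_copy (R : realType) (S S' : set (R * R)) : Prop :=
  exists (s : R) (w : R * R), 0 < s /\ S' = [set s *: p + w | p in S].

Definition alpha_free (R : realType) (alpha : R) (V : finType)
    (S : V -> set (R * R)) : Prop :=
  forall v : V, (alpha%:E * area (S v) <=
    area (S v `\` \bigcup_(u in [set u | u != v]) S u))%E.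

Definition is_intersection_graph (R : realType) (G : sgraph)
    (S : G -> set (R * R)) : Prop :=
  forall u v : G, adj u v <-> u != v /\ S u `&` S v !=set0.

Definition free_homothet_graphs (R : realType) (S : set (R * R)) (alpha : R)
    (G : sgraph) : Prop :=
  exists F : G -> set (R * R),
    [/\ forall v : G, homothetic_copy S (F v),
        alpha_free alpha F
      & is_intersection_graph F].

(* Main.v *)
(* In the strong product of a path with a graph of treewidth t, consider the
   preimages of the bags.  In a graph G of radius r such a preimage X has O(t r)
   vertices, and meets every neighbourhood in O(t) of them.  If one can assign to
   each such X a nonempty connected core outside X, antitonely in X, then every
   node of the decomposition tree points towards its core, and this is impossible
   in a finite tree.

   The graph built here is a comb of g + 1 teeth joined at a root.  A tooth is a
   chain of large triangles.  The left and lower sides of each are crossed by w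
   pairs of geometrically growing wings, so that the crossings stay a small
   fraction of the area.  Bundles of Q lanes of pairwise interior-disjoint unit
   triangles leave the wings: vertical ones downwards and horizontal ones
   leftwards, to cross the vertical lanes of the previous tooth.  The lanes have
   length O(Q), which bounds r by O(Q), whereas there are about g Q of them, with g
   arbitrarily large; so X leaves whole rows and columns of lanes intact.  Rows are
   joined from one tooth to the next by the wings, since X meets the neighbourhood
   of a large triangle in fewer than w vertices.  The intact lanes of the intact
   rows form the core. *)
Require Import Defs.
From mathcomp Require Import all_boot all_order all_algebra.
From mathcomp Require Import zify.

Set Implicit Arguments.
Unset Strict Implicit.
Unset Printing Implicit Defensive.

Import Order.TTheory GRing.Theory Num.Theory.

(** * Trees and tree decompositions *)

(** Reachability in [G] minus [X]; as a [connect], it also relates each vertex of [X] to itself. *)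
Definition linked (G : sgraph) (X : {set G}) : rel G :=
  connect [rel u v | [&& adj u v, u \notin X & v \notin X]].

Section Linked.
Variables (G : sgraph) (X : {set G}).

Lemma linked_sym : symmetric (linked X).
Proof.
apply: sym_connect_sym => u v /=.
by rewrite adj_sym; congr andb; rewrite andbC.
Qed.

Lemma linked_refl x : linked X x x. Proof. exact: connect0. Qed.

Lemma linked_trans : transitive (linked X).
Proof. exact: connect_trans. Qed.

Lemma linked1 x y : adj x y -> x \notin X -> y \notin X -> linked X x y.
Proof. by move=> xy xX yX; apply: connect1; rewrite /= xy xX yX. Qed.

Lemma connected_linked (A : {set G}) x y :
  connected_in A -> [disjoint A & X] -> x \in A -> y \in A -> linked X x y.
Proof.
move=> cA dAX xA yA; apply: connect_sub (cA _ _ xA yA) => u v /= /and3P[uv uA vA].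
by apply: linked1; rewrite ?(disjointFr dAX).
Qed.

End Linked.

Section Tree.
Variable T : sgraph.
Hypothesis treeT : is_tree T.

(** Iterating [nxt] ends in a periodic orbit, which is a [ucycle] of the tree. Its length is at most
    2 by acyclicity, and not 1 since there are no loops. *)
Lemma tree_involution (nxt : T -> T) :
  (forall i, adj i (nxt i)) -> exists i, nxt (nxt i) = i.
Proof.
move=> adjn; have [/card_gt0P[x _] _ acyc] := treeT.
have /trajectP[m mlt xm] := looping_order nxt x.
pose y := iter m nxt x.
have yk : iter (order nxt x - m) nxt y = y by rewrite -iterD subnK // ltnW.
have ky : (0 < order nxt x - m)%N by rewrite subn_gt0.
have cy : fcycle nxt (orbit nxt y).
  apply/(orbitPcycle 0 3); exists (order nxt x - m).-1.
  by rewrite prednK.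
have c2 : cycle (@adj T) (orbit nxt y).
  by apply: sub_cycle cy => u v /= /eqP <-.
have := acyc (orbit nxt y); rewrite /ucycle c2 orbit_uniq => /(_ isT).
rewrite size_orbit => o2.
have oE : iter (order nxt y) nxt y = y by exact/(orbitPcycle 0 4).
have := order_gt0 nxt y; case: (order nxt y) o2 oE => [|[|[|]]] //= _.
  by move=> e; have := adjn y; rewrite e adj_irrefl.
by move=> e _; exists y.
Qed.

(* Otherwise a path from i' to i avoiding the edge ii' would close up to a cycle. *)
Lemma tree_edge_separates (i i' z : T) :
  adj i i' -> linked [set i] i' z -> linked [set i'] z i -> False.
Proof.
move=> ii' l1 l2; have [_ _ acyc] := treeT.
pose e := [rel u v : T | adj u v && ~~ (((u == i) && (v == i')) || ((u == i') && (v == i)))].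
have ne : i != i' by apply/eqP => e_ok; move: ii'; rewrite e_ok adj_irrefl.
have : connect e i' i.
  apply: (@connect_trans _ _ z).
    apply: connect_sub l1 => u v /= /and3P[uv]; rewrite !inE => /negPf u1 /negPf v1.
    by apply: connect1; rewrite /= uv u1 v1 andbF.
  apply: connect_sub l2 => u v /= /and3P[uv]; rewrite !inE => /negPf u1 /negPf v1.
  by apply: connect1; rewrite /= uv u1 v1 andbF.
case/connectP => p0; case/shortenP => p pe up _ lp.
have := acyc (i' :: p).
rewrite /ucycle up andbT /= rcons_path -lp ii' andbT.
have -> : path (@adj T) i' p by apply: sub_path pe => u v /= /andP[].
move=> /(_ isT); case: p pe up lp => [|a [|b p]] //=.
  by move=> _ _ /eqP; rewrite (negPf ne).
by move=> /andP[/andP[_]] /= + _ _ ai; rewrite -ai !eqxx orbT.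
Qed.

(** [j] is the second vertex of a simple path from [i] to [z], the rest of which avoids [i]. *)
Lemma tree_step (i z : T) : z != i -> exists2 j, adj i j & linked [set i] j z.
Proof.
move=> zi; have [_ conn _] := treeT.
have /connectP[p0 pe0 ez] := conn i z (in_setT _) (in_setT _).
move: zi; rewrite {z}ez; case/shortenP: pe0 => p pe up _ zi.
case: p pe up zi => [|j p] /=; first by rewrite eqxx.
move=> /andP[/and3P[ij _ _] pe] /andP[ip up] zi.
exists j => //; apply/connectP; exists p => //.
move: ip; rewrite inE => /norP[].
elim: p j {ij up zi} pe => [|a p IH] j //= /andP[/and3P[ja _ _] pe] ij.
rewrite inE => /norP[ia ip].
by rewrite ja !inE eq_sym ij eq_sym ia /=; apply: IH.
Qed.
End Tree.

(** * Havens and the layers of the product *)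

Section Haven.
Variables (G H T : sgraph) (n : nat) (B : T -> {set H}).
Variable f : G -> strong_product H (path_graph n).
Hypothesis f_hom : {homo f : x y / adj x y}.
Hypothesis f_inj : injective f.
Hypothesis decB : is_tree_decomposition B.

Definition fibre (i : T) : {set G} := [set v | (f v).1 \in B i].

(** The walk in [G] lifts to [T]: consecutive vertices have their [H]-coordinates in a common bag,
    and the nodes whose bags contain a given vertex of [H] outside [B i] form a connected set
    avoiding [i]. *)
Lemma bag_linked i u v zu zv : linked (fibre i) u v -> u \notin fibre i ->
  (f u).1 \in B zu -> (f v).1 \in B zv -> linked [set i] zu zv.
Proof.
have [treeT cover edge conn] := decB.
have same w z z' : w \notin fibre i -> (f w).1 \in B z -> (f w).1 \in B z' ->
    linked [set i] z z'.
  move=> wi wz wz'; apply: connected_linked (conn (f w).1) _ _ _; rewrite ?inE//.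
  by rewrite disjoint_sym disjoints1 inE; move: wi; rewrite inE.
case/connectP => p pp ->{v}.
elim: p u zu pp => [|w p IH] u zu /=; first by move=> _; apply: same.
move=> /andP[/and3P[uw ui wi] pp] _ uzu vzv.
have [z uz wz] : exists2 z, (f u).1 \in B z & (f w).1 \in B z.
  have /and3P[_ /orP[/eqP uw1|uw1] _] := f_hom uw.
    by have [z zu'] := cover (f u).1; exists z => //; rewrite -uw1.
  by have [z /andP[]] := edge _ _ uw1; exists z.
by apply: linked_trans (same _ _ _ ui uzu uz) (IH _ _ pp wi wz vzv).
Qed.

(* Every node i of the tree has a neighbour pointing to where the core of its
   fibre lives.  Some two adjacent nodes point to each other, yet the common
   core of their fibres lies on one side of the edge joining them. *)
Lemma haven_absurd (core : {set G} -> {set G}) :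
  (forall i j, core (fibre i :|: fibre j) != set0) ->
  (forall i, [disjoint core (fibre i) & fibre i]) ->
  (forall i, {in core (fibre i) &, forall x y, linked (fibre i) x y}) ->
  (forall i j, core (fibre i :|: fibre j) \subset core (fibre i)) -> False.
Proof.
move=> core_ne core_out core_linked core_mono.
have [treeT cover _ _] := decB.
have /(_ _)/set0Pn/sigW core_pick i := core_ne i i.
have core_pick' i : {p | p \in core (fibre i)}.
  by have [p pc] := core_pick i; exists p; apply: (subsetP (core_mono i i)).
pose p i := sval (core_pick' i).
have pP i : p i \in core (fibre i) by rewrite /p; case: (core_pick' i).
have out i v : v \in core (fibre i) -> v \notin fibre i.
  by move=> vc; rewrite (disjointFr (core_out i) vc).
have node v : {z | (f v).1 \in B z} by apply/sigW/cover.
have step i : {j | adj i j && linked [set i] j (sval (node (p i)))}.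
  apply/sigW; have [|j ij jz] := tree_step treeT (_ : sval (node (p i)) != i).
    apply/eqP => e; have := out _ _ (pP i); rewrite inE.
    by have := svalP (node (p i)); rewrite /= e => ->.
  by exists j; rewrite ij.
pose nxt i := sval (step i).
have nxtP i : adj i (nxt i) /\ linked [set i] (nxt i) (sval (node (p i))).
  by rewrite /nxt; case: (step i) => j /= /andP[].
have [i nni] := tree_involution treeT (fun i => (nxtP i).1).
have /set0Pn[c cc] := core_ne i (nxt i).
have ci := subsetP (core_mono _ _) _ cc.
have cj : c \in core (fibre (nxt i)).
  by apply: (subsetP (core_mono (nxt i) i)); rewrite finset.setUC.
(* [c] and [p k] lie in one core, hence are linked outside the fibre: the pointer of [k] leads to
   the bag of [c] as well. *)
have toc k : c \in core (fibre k) -> linked [set k] (nxt k) (sval (node c)).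
  move=> ck; apply: linked_trans (nxtP k).2 _.
  by apply: bag_linked (core_linked k _ _ (pP k) ck) (out _ _ (pP k)) (svalP (node _)) (svalP (node _)).
apply: (tree_edge_separates treeT (nxtP i).1 (toc _ ci)).
by rewrite linked_sym; have := toc _ cj; rewrite nni.
Qed.

Definition layer (v : G) : nat := (f v).2.

Lemma layer_adj u v : adj u v -> layer u <= (layer v).+1.
Proof.
move=> /f_hom /and3P[_ _ /orP[/eqP uv|]]; first by rewrite /layer uv.
by rewrite /layer /= /path_adj => /orP[/eqP|/eqP <-//]; lia.
Qed.

(** Injectivity of [f] leaves at most one vertex per pair of a bag element and a layer, and there
    are [2 * d + 1] layers within distance [d] of [c]. *)
Lemma card_fibre_layers (A : {set G}) i c d :
  A \subset fibre i -> {in A, forall v, (layer v <= c + d) && (c <= layer v + d)} ->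
  #|A| <= #|B i| * (2 * d).+1.
Proof.
move=> Ai near.
(* By [near] the offset lies between 0 and [2 * d], so neither the truncated subtraction nor [inord]
   loses information. *)
pose g (v : G) : H * 'I_(2 * d).+1 := ((f v).1, inord (layer v + d - c)).
have gi : {in A &, injective g}.
  move=> u v uA vA [uv1 /(congr1 val)] /=.
  have /andP[u1 u2] := near _ uA; have /andP[v1 v2] := near _ vA.
  rewrite !inordK; try lia; move=> uv2.
  have e2 : (f u).2 = (f v).2.
    by apply: val_inj; move: u1 u2 v1 v2 uv2; rewrite /layer /=; lia.
  by apply: f_inj; rewrite [f u]surjective_pairing uv1 e2 -surjective_pairing.
have -> : #|B i| * (2 * d).+1 = #|finset.setX (B i) [set: 'I_(2 * d).+1]|.
  by rewrite cardsX cardsT card_ord.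
rewrite -(card_in_imset gi); apply/subset_leq_card/subsetP => _ /imsetP[v vA ->].
by rewrite !inE /= andbT; have := subsetP Ai _ vA; rewrite inE.
Qed.
End Haven.

Definition within (G : sgraph) (r : nat) (x y : G) : Prop :=
  exists2 p, path (@adj G) x p & last x p = y /\ size p <= r.

(* Distances from x0 bound the number of layers, neighbourhoods meet at most
   three layers, and the thin sets that matter are unions of two fibres. *)
Lemma product_obstruction (G : sgraph) (t r : nat) (x0 : G)
    (core : {set G} -> {set G})
    (thin := fun X : {set G} => #|X| <= 2 * t.+1 * (2 * r).+1 /\
       forall u, #|[set v in X | adj u v]| <= 6 * t.+1) :
  (forall v, within r x0 v) ->
  (forall X, thin X -> core X != set0) ->
  (forall X, [disjoint core X & X]) ->
  (forall X, thin X -> {in core X &, forall x y, linked X x y}) ->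
  (forall X Y : {set G}, X \subset Y -> core Y \subset core X) ->
  forall (H : sgraph) (n : nat), treewidth_at_most H t ->
    ~ is_subgraph G (strong_product H (path_graph n)).
Proof.
move=> near core_ne core_out core_linked core_mono H n [T [B [decB wB]]] [f f_inj f_hom].
have bag i : #|B i| <= t.+1.
  have : #|B i| <= \max_(i : T) #|B i| by apply: leq_bigmax.
  by move: wB; rewrite /width; case: (\max_(i : T) _) => //= *; lia.
have walk p x : path (@adj G) x p ->
    (layer f (last x p) <= layer f x + size p) && (layer f x <= layer f (last x p) + size p).
  elim: p x => [|w p IH] x /=; first lia.
  move=> /andP[xw pp]; have := IH w pp; have := layer_adj f_hom xw.
  by have := layer_adj f_hom (etrans (adj_sym w x) xw); lia.
have lay v : (layer f v <= layer f x0 + r) && (layer f x0 <= layer f v + r).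
  by have [p pp [<- sp]] := near v; have := walk _ _ pp; lia.
have thinU i j : thin (fibre B f i :|: fibre B f j).
  split=> [|u].
    apply: leq_trans (leq_card_setU _ _) _.
    have h k : #|fibre B f k| <= t.+1 * (2 * r).+1.
      apply: leq_trans (card_fibre_layers f_inj (subxx _) (fun v _ => lay v)) _.
      by rewrite leq_mul2r bag orbT.
    by have := h i; have := h j; lia.
  rewrite (_ : [set v in _ | _] = [set v in fibre B f i | adj u v] :|: [set v in fibre B f j | adj u v]); last first.
    by apply/setP => v; rewrite !inE andb_orl.
  apply: leq_trans (leq_card_setU _ _) _.
  have h k : #|[set v in fibre B f k | adj u v]| <= t.+1 * 3.
    apply: leq_trans (card_fibre_layers f_inj (B := B) (i := k) (c := layer f u) (d := 1) _ _) _.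
    - by apply/subsetP => v; rewrite inE => /andP[].
    - move=> v; rewrite inE => /andP[_ uv].
      have vu : adj v u by rewrite adj_sym.
      by have := layer_adj f_hom uv; have := layer_adj f_hom vu; lia.
    - by rewrite leq_mul2r bag orbT.
  by have := h i; have := h j; lia.
have thin1 i : thin (fibre B f i) by rewrite -(setUid (fibre B f i)).
apply: (haven_absurd f_hom decB (core := core)) => // i *; first exact: core_ne.
- exact: core_linked.
- by apply: core_mono; apply: subsetUl.
Qed.

(** Stated for [Prop]-valued relations, so as to serve rows, columns and single lanes alike. *)
Lemma ord_chain (g : nat) (R : 'I_g -> 'I_g -> Prop) :
  (forall i, R i i) -> (forall i j, R i j -> R j i) ->
  (forall i j k, R i j -> R j k -> R i k) ->
  (forall i j : 'I_g, j = i.+1 :> nat -> R i j) -> forall i j, R i j.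
Proof.
move=> Rr Rs Rt R1.
have up k : forall i j : 'I_g, j = i + k :> nat -> R i j.
  elim: k => [|k IH] i j ij; first by rewrite (_ : j = i)//; apply: val_inj; rewrite /= ij addn0.
  have jg : i + k < g by have := ltn_ord j; lia.
  by apply: Rt (IH i (Ordinal jg) erefl) (R1 _ _ _); rewrite /= ij addnS.
move=> i j; case: (leqP i j) => ij; first by apply: (up (j - i)); rewrite subnKC.
by apply/Rs/(up (i - j)); rewrite subnKC // ltnW.
Qed.

(** * Grids of crossing lanes *)

Section Lanes.
Variables (G : sgraph) (g w Q : nat).
(** The indices are the gap between teeth [b] and [b.+1], the level, the wing and the lane in its
    bundle. In gap [b], the lanes [V] hang from tooth [b] and the lanes [H] come from tooth
    [b.+1]. *)
Variables V H : 'I_g -> 'I_g -> 'I_w -> 'I_Q -> {set G}.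
Hypothesis V_conn : forall b l m z, connected_in (V b l m z).
Hypothesis H_conn : forall b l m z, connected_in (H b l m z).
Hypothesis VH : forall b l m z m' z', V b l m z :&: H b l m' z' != set0.
Hypothesis VH_next : forall b (l l' : 'I_g) m z m' z', l' = l.+1 :> nat ->
  V b l' m z :&: H b l m' z' != set0.
Hypothesis V_inj : forall v b l m z b' l' m' z',
  v \in V b l m z -> v \in V b' l' m' z' -> [/\ b = b', l = l' & z = z'].
Hypothesis H_inj : forall v b l m z b' l' m' z',
  v \in H b l m z -> v \in H b' l' m' z' -> [/\ b = b', l = l' & z = z'].
Hypothesis crossing : forall b b' l : 'I_g, b' = b.+1 :> nat ->
  exists (u : G) (J K : 'I_w -> G),
    [/\ injective J /\ injective K, forall m m', J m != K m',
        forall m, [&& adj u (J m), adj u (K m) & adj (J m) (K m)],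
        forall m z, exists2 v, v \in H b l m z & adj v (J m)
      & forall m z, exists2 v, v \in V b' l m z & adj v (K m)].

Implicit Types X : {set G}.

(** All wings [m] are required, because the one spared by [X] at a crossing is not known
    beforehand. *)
Definition cell_good X b l : bool :=
  [forall m, [exists z, [disjoint V b l m z & X]] && [exists z, [disjoint H b l m z & X]]].

Definition row_good X l : bool := [forall b, cell_good X b l].

Definition cell_clear X b l (p : G) : bool :=
  [exists m, [exists z, ((p \in V b l m z) && [disjoint V b l m z & X])
                     || ((p \in H b l m z) && [disjoint H b l m z & X])]].

Definition core X : {set G} :=
  [set p | [exists l, row_good X l && [exists b, cell_clear X b l p]]].

(** In a bad cell [X] hits all [Q] lanes of some bundle. A vertex accounts for one pair of a cell
    and a [z] in each of the two directions, hence the factor 2. *)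
Lemma bad_cells_bound X (c : 'I_g -> 'I_g * 'I_g) : injective c ->
  (forall i, ~~ cell_good X (c i).1 (c i).2) -> g * Q <= 2 * #|X|.
Proof.
move=> c_inj bad.
have hit i z : {sv : bool * G | (sv.2 \in X) &&
    [exists m, sv.2 \in (if sv.1 then V else H) (c i).1 (c i).2 m z]}.
  apply: sigW; have := bad i; rewrite negb_forall => /existsP[m].
  rewrite negb_and !negb_exists => /orP[] /forallP/(_ z); rewrite -setI_eq0 => /set0Pn[v];
    rewrite inE => /andP[vL vX].
  - by exists (true, v); rewrite /= vX; apply/existsP; exists m.
  - by exists (false, v); rewrite /= vX; apply/existsP; exists m.
pose phi (iz : 'I_g * 'I_Q) := sval (hit iz.1 iz.2).
have phi_inj : injective phi.
  move=> [i z] [j y]; rewrite /phi /=.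
  case: (hit i z) (hit j y) => [[s v] /= /andP[_ /existsP[m vm]]] [[s' v'] /= /andP[_ /existsP[m' vm']]].
  case=> /= es ev; move: vm vm'; rewrite -es -ev; case: s es => _ vm vm'.
    have [e1 e2 ->] := V_inj vm vm'.
    by congr pair; apply: c_inj; rewrite [LHS]surjective_pairing e1 e2 -surjective_pairing.
  have [e1 e2 ->] := H_inj vm vm'.
  by congr pair; apply: c_inj; rewrite [LHS]surjective_pairing e1 e2 -surjective_pairing.
have -> : 2 * #|X| = #|finset.setX [set: bool] X| by rewrite cardsX cardsT card_bool.
have -> : g * Q = #|[set phi x | x in [set: 'I_g * 'I_Q]]|.
  by rewrite card_imset // cardsT card_prod !card_ord.
apply/subset_leq_card/subsetP => _ /imsetP[[i z] _ ->].
by rewrite !inE /phi /=; case: (hit i z) => [[s v] /= /andP[]].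
Qed.

(** Otherwise one bad cell from each row makes an injective family of [g] bad cells. *)
Lemma good_row X : 2 * #|X| < g * Q -> exists l, row_good X l.
Proof.
move=> small; apply/existsP; apply: contraLR small; rewrite negb_exists -leqNgt => /forallP bad.
have pick l : {b | ~~ cell_good X b l}.
  by apply/sigW; have := bad l; rewrite negb_forall => /existsP.
by apply: (bad_cells_bound (c := fun l => (sval (pick l), l))) => [l l' []//|l]; exact: (svalP (pick l)).
Qed.

Lemma good_column X : 2 * #|X| < g * Q -> exists b, forall l, cell_good X b l.
Proof.
move=> small; suff /existsP[b /forallP bg] : [exists b, [forall l, cell_good X b l]] by exists b.
apply: contraLR small; rewrite negb_exists -leqNgt => /forallP bad.
have pick b : {l | ~~ cell_good X b l}.
  by apply/sigW; have := bad b; rewrite negb_forall => /existsP.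
by apply: (bad_cells_bound (c := fun b => (b, sval (pick b)))) => [b b' []//|b]; exact: (svalP (pick b)).
Qed.

Lemma crossing_linked X (A B : {set G}) p q :
  connected_in A -> connected_in B -> A :&: B != set0 ->
  [disjoint A & X] -> [disjoint B & X] -> p \in A -> q \in B -> linked X p q.
Proof.
move=> cA cB /set0Pn[c]; rewrite inE => /andP[Ac Bc] AX BX pA qB.
exact: linked_trans (connected_linked cA AX pA Ac) (connected_linked cB BX Bc qB).
Qed.

(* The w pairs (J m, K m) all lie in the neighbourhood of one vertex u, so X
   misses one of them, and this pair links an H lane to a V lane. *)
Lemma crossing_bridge X (b b' l : 'I_g) : b' = b.+1 :> nat ->
  (forall u, #|[set v in X | adj u v]| < w) -> cell_good X b l -> cell_good X b' l ->
  exists p q, [/\ cell_clear X b l p, cell_clear X b' l q & linked X p q].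
Proof.
move=> bb' few /forallP gb /forallP gb'.
have [u [J [K [[Ji Ki] JK uJK HJ VK]]]] := crossing l bb'.
have [m0 /norP[Jm Km]] : exists m, ~~ ((J m \in X) || (K m \in X)).
  apply/existsP; apply: contraLR (few u); rewrite negb_exists -leqNgt => /forallP h.
  (* If [X] hit every pair, [psi] would select [w] distinct elements of [X] in the neighbourhood of
     [u]. *)
  pose psi m := if J m \in X then J m else K m.
  have psi_inj : injective psi.
    move=> i j; rewrite /psi; case: ifP => _; case: ifP => _ // e.
    - exact: Ji.
    - by have := JK i j; rewrite e eqxx.
    - by have := JK j i; rewrite e eqxx.
    - exact: Ki.
  rewrite -[w in w <= _]card_ord -(card_imset predT psi_inj).
  apply/subset_leq_card/subsetP => _ /imsetP[i _ ->]; rewrite inE /psi.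
  have /and3P[uJ uK _] := uJK i; have := h i; rewrite negbK.
  by case: ifP => [JX _|_ /= KX]; rewrite ?JX ?KX ?uJ ?uK.
have /andP[_ /existsP[z cH]] := gb m0; have /andP[/existsP[z' cV] _] := gb' m0.
have [p pH pJ] := HJ m0 z; have [q qV qK] := VK m0 z'.
have pX : p \notin X by rewrite (disjointFr cH).
have qX : q \notin X by rewrite (disjointFr cV).
exists p, q; split.
- by apply/existsP; exists m0; apply/existsP; exists z; rewrite pH cH orbT.
- by apply/existsP; exists m0; apply/existsP; exists z'; rewrite qV cV.
have /and3P[_ _ JKm] := uJK m0.
apply: linked_trans (linked1 pJ pX Jm) _; apply: linked_trans (linked1 JKm Jm Km) _.
by apply: linked1; rewrite 1?adj_sym.
Qed.

Section Core.
Variable X : {set G}.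
Hypothesis w_gt0 : 0 < w.
Hypothesis small : 2 * #|X| < g * Q.
Hypothesis few : forall u, #|[set v in X | adj u v]| < w.

(** Vacuous for a cell without clear vertices, so transitivity asks for a good middle cell. *)
Let R (c c' : 'I_g * 'I_g) := forall p q,
  cell_clear X c.1 c.2 p -> cell_clear X c'.1 c'.2 q -> linked X p q.

Lemma cell_lanes b l : cell_good X b l -> exists m z m' z',
  [disjoint V b l m z & X] /\ [disjoint H b l m' z' & X].
Proof.
move=> /forallP/(_ (Ordinal w_gt0))/andP[/existsP[z cV] /existsP[z' cH]].
by exists (Ordinal w_gt0), z, (Ordinal w_gt0), z'.
Qed.

Lemma cell_clear_ne b l : cell_good X b l -> exists p, cell_clear X b l p.
Proof.
move=> /cell_lanes[m [z [m' [z' [cV _]]]]].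
have /set0Pn[p] := VH b l m z m' z'; rewrite inE => /andP[pV _].
by exists p; apply/existsP; exists m; apply/existsP; exists z; rewrite pV cV.
Qed.

(** [c] is the crossing of one fixed clear lane of each direction; every clear lane of the cell
    crosses one of these two. *)
Lemma cell_linked b l : cell_good X b l -> R (b, l) (b, l).
Proof.
move=> /cell_lanes[m0 [z0 [m1 [z1 [cV cH]]]]].
have /set0Pn[c] := VH b l m0 z0 m1 z1; rewrite inE => /andP[cV0 cH1].
suff toc p : cell_clear X b l p -> linked X p c.
  by move=> p q /toc pc /toc qc; apply: linked_trans pc _; rewrite linked_sym.
move=> /existsP[m /existsP[z /orP[/andP[pV dV]|/andP[pH dH]]]].
  exact: crossing_linked (VH b l m z m1 z1) dV cH pV cH1.
rewrite linked_sym.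
exact: crossing_linked (VH b l m0 z0 m z) cV dH cV0 pH.
Qed.

Lemma R_sym c c' : R c c' -> R c' c.
Proof. by move=> h p q pc qc; rewrite linked_sym; apply: h. Qed.

Lemma R_trans c1 c2 c3 : cell_good X c2.1 c2.2 -> R c1 c2 -> R c2 c3 -> R c1 c3.
Proof.
by move=> /cell_clear_ne[r rc] h1 h2 p q pc qc; apply: linked_trans (h1 _ _ pc rc) (h2 _ _ rc qc).
Qed.

Lemma R_join c1 c2 p q : cell_good X c1.1 c1.2 -> cell_good X c2.1 c2.2 ->
  cell_clear X c1.1 c1.2 p -> cell_clear X c2.1 c2.2 q -> linked X p q -> R c1 c2.
Proof.
case: c1 => b1 l1; case: c2 => b2 l2 /= g1 g2 p1 q2 pq x y x1 y2.
apply: linked_trans (cell_linked g1 x1 p1) _; apply: linked_trans pq _.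
exact: cell_linked g2 _ _ q2 y2.
Qed.

Lemma row_linked l b b' : row_good X l -> R (b, l) (b', l).
Proof.
move=> /forallP rg; apply: (ord_chain (R := fun i j => R (i, l) (j, l))).
- by move=> i; apply: cell_linked.
- by move=> i j; apply: R_sym.
- by move=> i j k; apply: R_trans; apply: rg.
- move=> i j ij; have [p [q [pc qc pq]]] := crossing_bridge ij few (rg i) (rg j).
  exact: (R_join (c1 := (i, l)) (c2 := (j, l)) (rg i) (rg j) pc qc pq).
Qed.

(** Within a gap, the vertical lanes of a level also cross the horizontal lanes of the level
    below. *)
Lemma column_linked b l l' : (forall k, cell_good X b k) -> R (b, l) (b, l').
Proof.
move=> cg; apply: (ord_chain (R := fun i j => R (b, i) (b, j))).
- by move=> i; apply: cell_linked.
- by move=> i j; apply: R_sym.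
- by move=> i j k; apply: R_trans; apply: cg.
- move=> i j ij; have [m [z [_ [_ [cV _]]]]] := cell_lanes (cg j).
  have [_ [_ [m' [z' [_ cH]]]]] := cell_lanes (cg i).
  have /set0Pn[c] := VH_next b m z m' z' ij; rewrite inE => /andP[cV0 cH0].
  apply: (R_join (c1 := (b, i)) (c2 := (b, j)) (cg i) (cg j) (p := c) (q := c)); rewrite ?linked_refl //=.
    by apply/existsP; exists m'; apply/existsP; exists z'; rewrite cH0 cH orbT.
  by apply/existsP; exists m; apply/existsP; exists z; rewrite cV0 cV.
Qed.

(** Two good rows are joined through a good column. *)
Lemma core_linked : {in core X &, forall x y, linked X x y}.
Proof.
move=> x y; rewrite !inE => /existsP[l /andP[rl /existsP[b xb]]] /existsP[l' /andP[rl' /existsP[b' yb']]].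
have [c cg] := good_column small.
have h1 : R (b, l) (c, l) by exact: row_linked.
have h2 : R (c, l) (c, l') by exact: column_linked.
have h3 : R (c, l') (b', l') by exact: row_linked.
have h4 : R (c, l) (b', l') by apply: R_trans h2 h3; apply: cg.
have h5 : R (b, l) (b', l') by apply: R_trans h1 h4; apply: cg.
by apply: h5; [exact: xb|exact: yb'].
Qed.

Lemma core_neq0 : core X != set0.
Proof.
have [l rl] := good_row small; have [b bg] := good_column small.
have [p pc] := cell_clear_ne (bg l); apply/set0Pn; exists p; rewrite inE.
by apply/existsP; exists l; rewrite rl; apply/existsP; exists b.
Qed.
End Core.

Lemma core_disjoint X : [disjoint core X & X].
Proof.
rewrite disjoints_subset; apply/subsetP => p; rewrite !inE.
move=> /existsP[l /andP[_ /existsP[b /existsP[m /existsP[z]]]]].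
by move=> /orP[] /andP[pL dL]; rewrite (disjointFr dL pL).
Qed.

Lemma core_antitone (X Y : {set G}) : X \subset Y -> core Y \subset core X.
Proof.
move=> XY; have dXY (A : {set G}) : [disjoint A & Y] -> [disjoint A & X].
  by rewrite ![[disjoint A & _]]disjoint_sym; apply: disjointWl.
apply/subsetP => p; rewrite !inE => /existsP[l /andP[/forallP rl /existsP[b /existsP[m /existsP[z pc]]]]].
apply/existsP; exists l; apply/andP; split.
  apply/forallP => b'; apply/forallP => m'; have /forallP/(_ m')/andP[/existsP[z1 h1] /existsP[z2 h2]] := rl b'.
  by apply/andP; split; apply/existsP; [exists z1|exists z2]; apply: dXY.
apply/existsP; exists b; apply/existsP; exists m; apply/existsP; exists z.
by case/orP: pc => /andP[-> /dXY ->]; rewrite ?orbT.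
Qed.
End Lanes.

Local Open Scope ring_scope.

(** * Integer triangles *)

(* (a, b, c) stands for the triangle {(x, y) | x >= a, y >= b, x + y <= c}, in
   affine coordinates in which T is the triangle (0, 0, 1). *)
Definition triple := (int * int * int)%type.

(* max a a' + max b b' <= min c c' *)
Definition touch (u v : triple) : bool :=
  let: (a, b, c) := u in let: (a', b', c') := v in
  [&& [&& a + b <= c, a + b' <= c, a' + b <= c & a' + b' <= c] &
      [&& a + b <= c', a + b' <= c', a' + b <= c' & a' + b' <= c']].

(* For nondegenerate triangles: the interiors are disjoint. *)
Definition disj (u v : triple) : bool :=
  let: (a, b, c) := u in let: (a', b', c') := v in
  [|| c <= a + b', c' <= a + b', c <= a' + b, c' <= a' + b, c <= a' + b' | c' <= a + b].

Definition unit_triple (x y : int) : triple := (x, y, x + y + 1).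

(** Lanes consist of such triangles, so two lanes overlap only in whole triangles common to both. *)
Lemma unit_triple_disj x y x' y' : (x, y) != (x', y') -> disj (unit_triple x y) (unit_triple x' y').
Proof. by rewrite xpair_eqE /disj /unit_triple; lia. Qed.

(* P separates the teeth of the comb, L the levels along a tooth. *)
Definition shift (P L : int) (v : triple) : triple :=
  let: (a, b, c) := v in (a + P + L, b - P + L, c + L + L).

(* A tooth is a chain of large nodes joined by links.  HWing and VWing cross the
   left, respectively lower, side of a node, and touch each other inside it. *)
Inductive piece := Link of int | Node | HWing of int & int | VWing of int & int.

(** * Shapes and disjointness of the pieces and lanes *)

Section Pieces.
Variables Q A : int.

(** Links of size [2 * Q] descend the diagonal from the corner (0, 0) of a node to the middle of the
    hypotenuse of the node one level below. A wing has size [e' - e]. An [HWing] fills the heights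
    from [e] to [e'], so consecutive wings fit side by side, and it meets the [VWing] with the same
    parameters at the point (e, e). *)
Definition shape (p : piece) : triple :=
  match p with
  | Link x => (- x - Q, - x - Q, - x - x)
  | Node => (0, 0, A + A)
  | HWing e e' => (e + e - e', e, e + e)
  | VWing e e' => (e, e + e - e', e + e)
  end.

Definition piece_ok (p : piece) : bool :=
  match p with
  | Link x => (0 <= x) && (x + Q <= A)
  | Node => true
  | HWing e e' | VWing e e' => [&& Q + Q <= e, e + e <= e' & e' <= A]
  end.

Definition piece_apart (p p' : piece) : bool :=
  match p, p' with
  | Link x, Link x' => (x + Q <= x') || (x' + Q <= x)
  | HWing e1 e1', HWing e2 e2' | VWing e1 e1', VWing e2 e2' => (e1' <= e2) || (e2' <= e1)
  | HWing e1 e1', VWing e2 e2' | VWing e1 e1', HWing e2 e2' =>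
      [|| e1' <= e2, e2' <= e1 | (e1 == e2) && (e1' == e2')]
  | Node, Link _ | Link _, Node | Link _, HWing _ _ | HWing _ _, Link _ | Link _, VWing _ _ | VWing _ _, Link _ => true
  | _, _ => false
  end.

Hypothesis Q_gt0 : 0 < Q.
Hypothesis QA : Q <= A.

(** These bounds suffice to separate different teeth and levels; only pieces around one node are
    compared case by case. *)
Lemma piece_bounds p : piece_ok p ->
  let: (a, b, c) := shape p in
  [&& a + b < c, - A - A <= a + b, c <= A + A, - A - A <= a + a - c, c - b - b <= A + A,
      [&& c - b <= A + A & c - a <= A + A] & (- A <= a) && (- A <= b)].
Proof. by case: p => [x| |e e'|e e'] /=; lia. Qed.

Lemma hub_disj_tooth P L P' L' p p' : piece_ok p -> piece_ok p' ->
  P + A *+ 8 <= P' -> disj (shift P L (shape p)) (shift P' L' (shape p')).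
Proof.
move=> /piece_bounds + /piece_bounds; case: (shape p) (shape p') => [[a b] c] [[a' b'] c'] /=.
by rewrite /disj /=; lia.
Qed.

Lemma hub_disj_level P L L' p p' : piece_ok p -> piece_ok p' ->
  L + A + A <= L' -> disj (shift P L (shape p)) (shift P L' (shape p')).
Proof.
move=> /piece_bounds + /piece_bounds; case: (shape p) (shape p') => [[a b] c] [[a' b'] c'] /=.
by rewrite /disj /=; lia.
Qed.

Lemma hub_disj_piece P L p p' : piece_ok p -> piece_ok p' -> piece_apart p p' ->
  disj (shift P L (shape p)) (shift P L (shape p')).
Proof. by case: p => [x| |e e'|e e']; case: p' => [x'| |f f'|f f'] //=; lia. Qed.

Lemma root_disj_hub M P L p : piece_ok p -> 0 <= L ->
  disj (- M, - M, - A - A) (shift P L (shape p)).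
Proof.
by move=> /piece_bounds; case: (shape p) => [[a b] c] /=; rewrite /disj /=; lia.
Qed.

(** The lower side of the [VWing] has height [e + e - e'] before shifting. The [- 1] puts the apex
    of the triangle [n = 0] on that side, and the apex of each later triangle is the corner of its
    predecessor. *)
Definition vlane_triple (P L e e' z n : int) : triple :=
  unit_triple (P + L + e + z) (- P + L + e + e - e' - 1 - n).
Definition hlane_triple (P L e e' z n : int) : triple :=
  unit_triple (P + L + e + e - e' - 1 - n) (- P + L + e + z).

Section LaneHub.
Variables (P L e e' z n : int).
Hypothesis e_ok : [&& Q + Q <= e, e + e <= e' & e' <= A].
Hypothesis z_bd : (0 <= z) && (z < Q).
Hypothesis n_ge0 : 0 <= n.

Lemma vlane_disj_tooth P' L' p : n < A *+ 10 -> piece_ok p -> (P + A *+ 8 <= P') || (P' + A *+ 8 <= P) ->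
  disj (vlane_triple P L e e' z n) (shift P' L' (shape p)).
Proof.
by move=> nA /piece_bounds; case: (shape p) => [[a b] c] /=; rewrite /disj /vlane_triple /unit_triple /=; lia.
Qed.

Lemma vlane_disj_level L' p : piece_ok p -> (L + A + A <= L') || (L' + A + A <= L) ->
  disj (vlane_triple P L e e' z n) (shift P L' (shape p)).
Proof.
by move=> /piece_bounds; case: (shape p) => [[a b] c] /=; rewrite /disj /vlane_triple /unit_triple /=; lia.
Qed.

Definition lane_apart (p : piece) : bool :=
  match p with
  | Link _ | Node => true
  | HWing f f' | VWing f f' => [|| e' <= f, f' <= e | (e == f) && (e' == f')]
  end.

Lemma vlane_disj_piece p : piece_ok p -> lane_apart p ->
  disj (vlane_triple P L e e' z n) (shift P L (shape p)).
Proof. by case: p => [x| |f f'|f f'] /=; lia. Qed.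

Lemma hlane_disj_tooth P' L' p : n < A *+ 8 -> piece_ok p -> (P + A *+ 8 <= P') || (P' + A *+ 8 <= P) ->
  disj (hlane_triple P L e e' z n) (shift P' L' (shape p)).
Proof.
by move=> nA /piece_bounds; case: (shape p) => [[a b] c] /=; rewrite /disj /hlane_triple /unit_triple /=; lia.
Qed.

Lemma hlane_disj_level L' p : piece_ok p -> (L + A + A <= L') || (L' + A + A <= L) ->
  disj (hlane_triple P L e e' z n) (shift P L' (shape p)).
Proof.
by move=> /piece_bounds; case: (shape p) => [[a b] c] /=; rewrite /disj /hlane_triple /unit_triple /=; lia.
Qed.

Lemma hlane_disj_piece p : piece_ok p -> lane_apart p ->
  disj (hlane_triple P L e e' z n) (shift P L (shape p)).
Proof. by case: p => [x| |f f'|f f'] /=; lia. Qed.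

End LaneHub.
End Pieces.

Definition dilate (N : nat) (v : triple) : triple :=
  let: (a, b, c) := v in (N%:Z * a, N%:Z * b, N%:Z * c).

(* Dilated by N, so that it is integral: v shrunk by the factor (N - 3) / N. *)
Definition inner (N : nat) (v : triple) : triple :=
  let: (a, b, c) := v in
  (N%:Z * a + (c - a - b), N%:Z * b + (c - a - b), N%:Z * c - (c - a - b)).

Lemma touch_dilate N u v : (0 < N)%N -> touch (dilate N u) (dilate N v) = touch u v.
Proof.
move=> N0; case: u v => [[a b] c] [[a' b'] c']; rewrite /touch /dilate.
by rewrite -!mulrDr !ler_pM2l.
Qed.

(** Shrinking moves each side inwards by a positive amount, which makes the weak separation
    strict. *)
Lemma inner_disj N u v : (0 < N)%N -> disj u v ->
  (let: (a, b, c) := v in a + b < c) -> ~~ touch (inner N v) (dilate N u).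
Proof.
move=> N0; case: u v => [[a b] c] [[a' b'] c']; rewrite /disj /touch /dilate /inner => d s.
have M (x y z : int) : z <= x + y -> N%:Z * z <= N%:Z * x + N%:Z * y.
  by rewrite -mulrDr ler_pM2l.
by case/orP: d => [/M h|]; [lia|]; do 4 (case/orP => [/M h|]; [lia|]); move=> /M h; lia.
Qed.

Section Within.
Variable G : sgraph.

Lemma within_refl r (x : G) : within r x x.
Proof. by exists [::]. Qed.

Lemma within_le r s (x y : G) : (r <= s)%N -> within r x y -> within s x y.
Proof. by move=> rs [p pp [lp sp]]; exists p => //; split=> //; apply: leq_trans rs. Qed.

Lemma within_step r (x y z : G) : within r x y -> adj y z -> within r.+1 x z.
Proof.
move=> [p pp [lp sp]] yz; exists (rcons p z); rewrite ?rcons_path ?pp ?lp //.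
by rewrite last_rcons size_rcons.
Qed.

End Within.

Lemma touchC u v : touch u v = touch v u.
Proof. by case: u v => [[a b] c] [[a' b'] c']; rewrite /touch; lia. Qed.

Lemma disjC u v : disj u v = disj v u.
Proof. by case: u v => [[a b] c] [[a' b'] c']; rewrite /disj; lia. Qed.

(** * The comb *)

Section Comb.
Variables (g w Q kappa : nat).
Hypotheses (g_gt0 : (0 < g)%N) (w_gt0 : (0 < w)%N) (Q_gt0 : (0 < Q)%N) (kappa_gt1 : (1 < kappa)%N).

(** The number of links per level. It does not depend on [Q], so only the lanes make the radius grow
    with [Q]. *)
Definition chain_len : nat := (2 * kappa ^ w)%N.
Definition side : nat := (Q * chain_len)%N.
(** Wing [m] has parameters [eta m] and [eta m.+1]: the first wing starts at [2 * Q], clear of the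
    links, and the last one ends at [A]. *)
Definition eta (m : nat) : nat := (Q * (2 * kappa ^ m))%N.

Local Notation A := side.

Lemma etaS m : eta m.+1 = (kappa * eta m)%N.
Proof. by rewrite /eta expnS; lia. Qed.

Lemma eta_ge m : (2 * Q <= eta m)%N.
Proof. by have := expn_gt0 kappa m; rewrite /eta (ltnW kappa_gt1) /=; nia. Qed.

Lemma eta_step m : (2 * eta m <= eta m.+1)%N.
Proof. by rewrite etaS leq_mul2r kappa_gt1 orbT. Qed.

Lemma eta_mono m m' : (m <= m')%N -> (eta m <= eta m')%N.
Proof. by move=> mm; rewrite /eta !leq_mul2l leq_pexp2l ?orbT // ltnW. Qed.

Lemma eta_le m : (m < w)%N -> (eta m.+1 <= A)%N.
Proof. exact: eta_mono. Qed.

Lemma Q_le_A : (Q <= A)%N.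
Proof. by have := expn_gt0 kappa w; rewrite /side /chain_len (ltnW kappa_gt1) /=; nia. Qed.

Lemma eta_ok (m : 'I_w) :
  [&& Q%:Z + Q%:Z <= (eta m)%:Z, (eta m)%:Z + (eta m)%:Z <= (eta m.+1)%:Z &
      (eta m.+1)%:Z <= A%:Z].
Proof. by have := eta_ge m; have := eta_step m; have := eta_le (ltn_ord m); lia. Qed.

Definition pindex : Type := ((unit + 'I_chain_len) + ('I_w * bool))%type.

Definition piece_of (p : pindex) : piece :=
  match p with
  | inl (inl _) => Node
  | inl (inr r) => Link (Q * r)%N
  | inr (m, true) => HWing (eta m) (eta m.+1)
  | inr (m, false) => VWing (eta m) (eta m.+1)
  end.

Lemma piece_of_ok p : piece_ok Q A (piece_of p).
Proof.
case: p => [[[]|r]|[m []]] //=; try exact: eta_ok.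
have : (Q * r.+1 <= A)%N by rewrite leq_mul2l ltn_ord orbT.
by rewrite mulnS; lia.
Qed.

(** Lanes start from level 3 on, high enough for a descent of [10 * A] to stay above the root. The
    descent covers the [8 * A] between teeth and the [2 * A] between levels. *)
Definition hub (x : 'I_g.+1 * 'I_(g + 3) * pindex) : triple :=
  shift (8 * (x.1.1 * A))%N (2 * (x.1.2 * A))%N (shape Q A (piece_of x.2)).

(** With this extent the hypotenuse of the root passes through the lowest corners of all [g + 1]
    teeth. *)
Definition extent : nat := (8 * (g * A) + A)%N.

Definition root_triple : triple := (- extent%:Z, - extent%:Z, - A%:Z - A%:Z).

(* Column of unit triangles hanging down from the VWing m of tooth b; hlane is a
   row leading left from the HWing m of tooth b.+1. *)
Definition vlane (x : 'I_g * 'I_g * 'I_w * 'I_Q * 'I_(10 * A)) : triple :=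
  let: (b, l, m, z, n) := x in
  vlane_triple (8 * (b * A))%N (2 * ((l + 3) * A))%N (eta m) (eta m.+1) z n.

Definition hlane (x : 'I_g * 'I_g * 'I_w * 'I_Q * 'I_(8 * A)) : triple :=
  let: (b, l, m, z, n) := x in
  hlane_triple (8 * (b.+1 * A))%N (2 * ((l + 3) * A))%N (eta m) (eta m.+1) z n.

Definition verts : seq triple := root_triple :: codom hub ++ codom vlane ++ codom hlane.

Variant vert_spec : triple -> Prop :=
  | IsRoot : vert_spec root_triple
  | IsHub x : vert_spec (hub x)
  | IsV x : vert_spec (vlane x)
  | IsH x : vert_spec (hlane x).

Lemma vertsP v : v \in verts -> vert_spec v.
Proof.
rewrite inE => /orP[/eqP->|]; first exact: IsRoot.
by rewrite !mem_cat => /or3P[] /codomP[x ->]; [apply: IsHub|apply: IsV|apply: IsH].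
Qed.

Lemma root_verts : root_triple \in verts. Proof. exact: mem_head. Qed.
Lemma hub_verts x : hub x \in verts.
Proof. by rewrite inE mem_cat codom_f orbT. Qed.
Lemma vlane_verts x : vlane x \in verts.
Proof. by rewrite inE !mem_cat codom_f !orbT. Qed.
Lemma hlane_verts x : hlane x \in verts.
Proof. by rewrite inE !mem_cat codom_f !orbT. Qed.

(* The only overlapping pairs.  The wing has size e' - e and the overlap size e,
   so both are nearly free when kappa = e' / e is large. *)
Definition wing_overlap (u v : triple) : Prop :=
  exists (P L e e' : int), [/\ u = shift P L (shape Q A Node),
    v = shift P L (shape Q A (HWing e e')) \/ v = shift P L (shape Q A (VWing e e')),
    e' = kappa%:Z * e, 0 < e & e' <= A%:Z].

Lemma ltn_mulA (b b' : nat) : (b < b')%N -> (b * A + A <= b' * A)%N.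
Proof. by move=> bb; rewrite -mulSnr leq_mul2r bb orbT. Qed.

Lemma pieces_cases (p p' : pindex) : p != p' ->
  [\/ piece_apart Q (piece_of p) (piece_of p'),
      p = inl (inl tt) /\ (exists m, p' = inr m) |
      p' = inl (inl tt) /\ (exists m, p = inr m)].
Proof.
have et (m m' : 'I_w) : m != m' -> (eta m.+1 <= eta m')%N || (eta m'.+1 <= eta m)%N.
  by rewrite -val_eqE neq_ltn => /orP[] /eta_mono -> //; rewrite orbT.
have etC (m m' : 'I_w) :
    [|| ((eta m.+1)%:Z <= eta m'), ((eta m'.+1)%:Z <= eta m) | ((eta m)%:Z == eta m') && ((eta m.+1)%:Z == eta m'.+1)].
  by case: (eqVneq m m') => [->|/et]; rewrite ?eqxx ?orbT // !lez_nat => /orP[] ->; rewrite ?orbT.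
case: p p' => [[[]|r]|m] [[[]|r']|m'] ne.
- by rewrite eqxx in ne.
- exact: Or31.
- by apply: Or32; split=> //; exists m'.
- exact: Or31.
- apply: Or31 => /=.
  have : r != r' by apply: contraNneq ne => ->.
  rewrite -val_eqE neq_ltn => /orP[] h.
  - have : (Q * r.+1 <= Q * r')%N by rewrite leq_mul2l h orbT.
    by rewrite mulnS; lia.
  - have : (Q * r'.+1 <= Q * r)%N by rewrite leq_mul2l h orbT.
    by rewrite mulnS; lia.
- by apply: Or31; case: m' ne => m' [].
- by apply: Or33; split=> //; exists m.
- by apply: Or31; case: m ne => m [].
- case: m m' ne => [m s] [m' s'] ne; apply: Or31.
  case: s s' ne => [] [] ne /=; try exact: etC.
  - by rewrite !lez_nat; apply: et; apply: contraNneq ne => ->.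
  - by rewrite !lez_nat; apply: et; apply: contraNneq ne => ->.
Qed.

Lemma hub_disj x y : x != y ->
  [\/ disj (hub x) (hub y), wing_overlap (hub x) (hub y) | wing_overlap (hub y) (hub x)].
Proof.
have tip P L m : wing_overlap (shift P L (shape Q A Node)) (shift P L (shape Q A (piece_of (inr m)))).
  case: m => m s; exists P, L, (eta m)%:Z, (eta m.+1)%:Z; split=> //.
  - by case: s; [left|right].
  - by rewrite etaS.
  - by have := eta_ge m; lia.
  - exact: eta_le.
have Qz : 0 < Q%:Z by lia.
have QAz : Q%:Z <= A%:Z by exact: Q_le_A.
case: x y => [[b l] p] [[b' l'] p'] ne; rewrite /hub /=.
have okp := piece_of_ok p; have okp' := piece_of_ok p'.
case: (ltngtP b b') => [bb|bb|/val_inj bb].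
- by apply: Or31; apply: hub_disj_tooth => //; have := ltn_mulA bb; lia.
- by apply: Or31; rewrite disjC; apply: hub_disj_tooth => //; have := ltn_mulA bb; lia.
subst b'; case: (ltngtP l l') => [ll|ll|/val_inj ll].
- by apply: Or31; apply: hub_disj_level => //; have := ltn_mulA ll; lia.
- by apply: Or31; rewrite disjC; apply: hub_disj_level => //; have := ltn_mulA ll; lia.
subst l'; have : p != p' by apply: contraNneq ne => ->.
case/pieces_cases => [h|[-> [m ->]]|[-> [m ->]]].
- by apply: Or31; apply: hub_disj_piece.
- exact: Or32.
- exact: Or33.
Qed.

Lemma lane_apart_of (m : 'I_w) p : lane_apart (eta m) (eta m.+1) (piece_of p).
Proof.
case: p => [[[]|r]|[m' s]] //.
suff : [|| ((eta m.+1)%:Z <= eta m'), ((eta m'.+1)%:Z <= eta m) | ((eta m)%:Z == eta m') && ((eta m.+1)%:Z == eta m'.+1)].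
  by case: s.
rewrite !lez_nat; case: (ltngtP m m') => [h|h|/val_inj ->]; rewrite ?eqxx ?orbT //.
- by rewrite eta_mono.
- by rewrite (eta_mono h) orbT.
Qed.

Lemma vlane_hub_disj x y : disj (vlane x) (hub y).
Proof.
case: x y => [[[[b l] m] z] n] [[b' l'] p]; rewrite /hub /=.
have Qz : 0 < Q%:Z by lia.
have QAz : Q%:Z <= A%:Z by exact: Q_le_A.
have okp := piece_of_ok p; have okm := eta_ok m.
have zb : (0 <= z%:Z) && (z%:Z < Q) by have := ltn_ord z; lia.
have nb : 0 <= n%:Z < A%:Z *+ 10 by have := ltn_ord n; lia.
case: (ltngtP b b') => [bb|bb|bb].
- by apply: vlane_disj_tooth => //; have := ltn_mulA bb; lia.
- by apply: vlane_disj_tooth => //; have := ltn_mulA bb; lia.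
rewrite -bb; case: (ltngtP (l + 3) l')%N => [ll|ll|<-].
- by apply: vlane_disj_level => //; have := ltn_mulA ll; lia.
- by apply: vlane_disj_level => //; have := ltn_mulA ll; lia.
- by apply: vlane_disj_piece => //; exact: lane_apart_of.
Qed.

Lemma hlane_hub_disj x y : disj (hlane x) (hub y).
Proof.
case: x y => [[[[b l] m] z] n] [[b' l'] p]; rewrite /hub /=.
have Qz : 0 < Q%:Z by lia.
have QAz : Q%:Z <= A%:Z by exact: Q_le_A.
have okp := piece_of_ok p; have okm := eta_ok m.
have zb : (0 <= z%:Z) && (z%:Z < Q) by have := ltn_ord z; lia.
have nb : 0 <= n%:Z < A%:Z *+ 8 by have := ltn_ord n; lia.
case: (ltngtP b.+1 b') => [bb|bb|bb].
- by apply: hlane_disj_tooth => //; have := ltn_mulA bb; lia.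
- by apply: hlane_disj_tooth => //; have := ltn_mulA bb; lia.
rewrite -bb; case: (ltngtP (l + 3) l')%N => [ll|ll|<-].
- by apply: hlane_disj_level => //; have := ltn_mulA ll; lia.
- by apply: hlane_disj_level => //; have := ltn_mulA ll; lia.
- by apply: hlane_disj_piece => //; exact: lane_apart_of.
Qed.

Lemma root_hub_disj y : disj root_triple (hub y).
Proof.
case: y => [[b l] p]; apply: root_disj_hub; [lia|exact: Q_le_A|exact: piece_of_ok|lia].
Qed.

Lemma root_vlane_disj x : disj root_triple (vlane x).
Proof.
case: x => [[[[b l] m] z] n]; rewrite /root_triple /vlane /vlane_triple /unit_triple /disj.
by have := eta_ok m; have := ltn_ord n; lia.
Qed.

Lemma root_hlane_disj x : disj root_triple (hlane x).
Proof.
case: x => [[[[b l] m] z] n]; rewrite /root_triple /hlane /hlane_triple /unit_triple /disj.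
by have := eta_ok m; have := ltn_ord n; lia.
Qed.

Lemma verts_disj u v : u \in verts -> v \in verts -> u != v ->
  [\/ disj u v, wing_overlap u v | wing_overlap v u].
Proof.
have fd (u' v' : triple) x y x' y' : u' = unit_triple x y -> v' = unit_triple x' y' -> u' != v' -> disj u' v'.
  by move=> -> -> h; apply: unit_triple_disj; apply: contraNneq h => -[-> ->].
have fV x : exists a c, vlane x = unit_triple a c by case: x => [[[[b l] m] z] n]; do 2 eexists.
have fH x : exists a c, hlane x = unit_triple a c by case: x => [[[[b l] m] z] n]; do 2 eexists.
move=> /vertsP[|x|x|x] /vertsP[|y|y|y] ne.
- by rewrite eqxx in ne.
- by apply: Or31; apply: root_hub_disj.
- by apply: Or31; apply: root_vlane_disj.
- by apply: Or31; apply: root_hlane_disj.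
- by apply: Or31; rewrite disjC; apply: root_hub_disj.
- by apply: hub_disj; apply: contraNneq ne => ->.
- by apply: Or31; rewrite disjC; apply: vlane_hub_disj.
- by apply: Or31; rewrite disjC; apply: hlane_hub_disj.
- by apply: Or31; rewrite disjC; apply: root_vlane_disj.
- by apply: Or31; apply: vlane_hub_disj.
- by have [? [? ex]] := fV x; have [? [? ey]] := fV y; apply: Or31; apply: fd ex ey ne.
- by have [? [? ex]] := fV x; have [? [? ey]] := fH y; apply: Or31; apply: fd ex ey ne.
- by apply: Or31; rewrite disjC; apply: root_hlane_disj.
- by apply: Or31; apply: hlane_hub_disj.
- by have [? [? ex]] := fH x; have [? [? ey]] := fV y; apply: Or31; apply: fd ex ey ne.
- by have [? [? ex]] := fH x; have [? [? ey]] := fH y; apply: Or31; apply: fd ex ey ne.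
Qed.

Lemma verts_size v : v \in verts -> let: (a, b, c) := v in a + b < c.
Proof.
case/vertsP => [|[[b l] p]|[[[[b l] m] z] n]|[[[[b l] m] z] n]].
- have := Q_le_A; have : (A <= g * A)%N by rewrite leq_pmull.
  by rewrite /root_triple /extent; lia.
- have Qz : 0 < Q%:Z by lia.
  have QAz : Q%:Z <= A%:Z by exact: Q_le_A.
  have := piece_bounds Qz QAz (piece_of_ok p).
  by rewrite /hub /=; case: (shape _ _ _) => [[a c] d] /=; lia.
- by rewrite /vlane /vlane_triple /unit_triple; lia.
- by rewrite /hlane /hlane_triple /unit_triple; lia.
Qed.

(** Vertices are triples rather than indices, so the triangle where two lanes cross is a single
    vertex of both. *)
Definition comb_adj (u v : seq_sub verts) : bool :=
  (u != v) && touch (val u) (val v).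

Lemma comb_adj_sym : symmetric comb_adj.
Proof. by move=> u v; rewrite /comb_adj eq_sym touchC. Qed.

Lemma comb_adj_irrefl : irreflexive comb_adj.
Proof. by move=> u; rewrite /comb_adj eqxx. Qed.

Definition comb : sgraph := SGraph comb_adj_sym comb_adj_irrefl.

Definition root_vertex : comb := SeqSub root_verts.
Definition hub_vertex x : comb := SeqSub (hub_verts x).
Definition vlane_vertex x : comb := SeqSub (vlane_verts x).
Definition hlane_vertex x : comb := SeqSub (hlane_verts x).

Lemma touch_within r (u v : comb) : within r root_vertex u -> touch (val u) (val v) ->
  within r.+1 root_vertex v.
Proof.
move=> ru uv; case: (eqVneq u v) => [<-|ne]; first exact: within_le ru.
by apply: within_step ru _; rewrite /= /comb_adj ne.
Qed.

Definition vset b l m z : {set comb} := [set v | v \in codom (fun n => vlane_vertex (b, l, m, z, n))].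
Definition hset b l m z : {set comb} := [set v | v \in codom (fun n => hlane_vertex (b, l, m, z, n))].

Lemma chain_connected N (f : 'I_N -> comb) :
  (forall i j : 'I_N, j = i.+1 :> nat -> touch (val (f i)) (val (f j))) ->
  connected_in [set v | v \in codom f].
Proof.
move=> step x y; rewrite !inE => /codomP[i ->] /codomP[j ->].
set e := [rel u v | _].
have es : symmetric e.
  by move=> u v; rewrite /e /= comb_adj_sym [(v \in _) && _]andbC.
apply: (ord_chain (R := fun i j => connect e (f i) (f j))).
- by move=> *; exact: connect0.
- by move=> i' j'; rewrite (sym_connect_sym es).
- by move=> i' j' k'; apply: connect_trans.
- move=> i' j' ij; case: (eqVneq (f i') (f j')) => [->|ne]; first exact: connect0.
  by apply: connect1; rewrite /= !inE !codom_f !andbT /comb_adj ne step.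
Qed.

Lemma vset_conn b l m z : connected_in (vset b l m z).
Proof.
by apply: chain_connected => i j ij; rewrite /touch /= ij; lia.
Qed.

Lemma hset_conn b l m z : connected_in (hset b l m z).
Proof.
by apply: chain_connected => i j ij; rewrite /touch /= ij; lia.
Qed.

Lemma lanes_cross (b l l' : 'I_g) m z m' z' : ((l' == l :> nat) || (l' == l.+1 :> nat)) ->
  vset b l' m z :&: hset b l m' z' != set0.
Proof.
move=> ll; have okm := eta_ok m; have okm' := eta_ok m'.
have zQ := ltn_ord z; have zQ' := ltn_ord z'.
pose k : nat := ((l' - l) * A)%N.
have lA : (l' * A = l * A + k)%N.
  by rewrite /k mulnBl subnKC // leq_mul2r; case/orP: ll => /eqP ->; rewrite ?leqnn ?leqnSn orbT.
have kA : (k <= A)%N.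
  by rewrite /k -[leqRHS]mul1n leq_mul2r; case/orP: ll => /eqP ->; rewrite ?subnn ?subSnn ?orbT.
(* Both positions come from equating the coordinates of the two unit triangles; [2 * k] is the
   difference in level. *)
have n1 : (8 * A + 2 * k + 2 * eta m - (eta m.+1 + 1 + eta m' + z') < 10 * A)%N by lia.
have n2 : (8 * A + 2 * eta m' - (2 * k + eta m'.+1 + 1 + eta m + z) < 8 * A)%N by lia.
apply/set0Pn; exists (vlane_vertex (b, l', m, z, Ordinal n1)); rewrite !inE; apply/andP; split; apply/codomP.
  by exists (Ordinal n1).
exists (Ordinal n2); apply: val_inj => /=.
by rewrite /vlane_triple /hlane_triple /unit_triple; congr (_, _, _); lia.
Qed.

(** The slots of length [Q] starting at the [eta m] are disjoint and stay below the level spacing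
    [2 * A]. *)
Lemma lane_level (a b : nat) (m m' : 'I_w) (z z' : 'I_Q) :
  (2 * ((a + 3) * A) + eta m + z = 2 * ((b + 3) * A) + eta m' + z')%N -> a = b /\ m = m' /\ z = z'.
Proof.
move=> e; have okm := eta_ok m; have okm' := eta_ok m'.
have zQ := ltn_ord z; have zQ' := ltn_ord z'.
have ab : a = b by case: (ltngtP a b) => // h; have := ltn_mulA h; lia.
subst b; split=> //.
have mm : m = m'.
  by apply: val_inj; case: (ltngtP m m') => // h; have := eta_mono h; lia.
subst m'; split=> //; have zz : z = z' :> nat by lia.
exact: val_inj.
Qed.

(** The level cancels in the difference of the coordinates, which varies along the lanes of a tooth
    by less than the [16 * A] between teeth. So it determines [b], and the first coordinate
    determines the rest. *)
Lemma vset_inj v b l m z b' l' m' z' : v \in vset b l m z -> v \in vset b' l' m' z' ->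
  [/\ b = b', l = l' & z = z'].
Proof.
rewrite !inE => /codomP[n ->] /codomP[n' /(congr1 val)] /=.
rewrite /vlane_triple /unit_triple => -[e1 e2 _].
have okm := eta_ok m; have okm' := eta_ok m'.
have zQ := ltn_ord z; have zQ' := ltn_ord z'.
have nQ := ltn_ord n; have nQ' := ltn_ord n'.
have bb : b = b'.
  by apply: val_inj; case: (ltngtP b b') => // h; have := ltn_mulA h; lia.
subst b'.
have [ll [mm zz]] : l = l' :> nat /\ m = m' /\ z = z' by apply: lane_level; lia.
by split=> //; apply: val_inj.
Qed.

Lemma hset_inj v b l m z b' l' m' z' : v \in hset b l m z -> v \in hset b' l' m' z' ->
  [/\ b = b', l = l' & z = z'].
Proof.
rewrite !inE => /codomP[n ->] /codomP[n' /(congr1 val)] /=.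
rewrite /hlane_triple /unit_triple => -[e1 e2 _].
have okm := eta_ok m; have okm' := eta_ok m'.
have zQ := ltn_ord z; have zQ' := ltn_ord z'.
have nQ := ltn_ord n; have nQ' := ltn_ord n'.
have bb : b = b'.
  by apply: val_inj; case: (ltngtP b b') => // h; have := ltn_mulA h; lia.
subst b'.
have [ll [mm zz]] : l = l' :> nat /\ m = m' /\ z = z' by apply: lane_level; lia.
by split=> //; apply: val_inj.
Qed.

Lemma side_gt0 : (0 < A)%N.
Proof. exact: leq_trans Q_le_A. Qed.

(** [u] is the node of tooth [b.+1] on level [l + 3], and [J m], [K m] are its wings: the rows of
    gap [b] start at the former, the columns of gap [b'] at the latter. *)
Lemma comb_crossing (b b' l : 'I_g) : b' = b.+1 :> nat ->
  exists (u : comb) (J K : 'I_w -> comb),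
    [/\ injective J /\ injective K, forall m m', J m != K m',
        forall m, [&& adj u (J m), adj u (K m) & adj (J m) (K m)],
        forall m z, exists2 v, v \in hset b l m z & adj v (J m)
      & forall m z, exists2 v, v \in vset b' l m z & adj v (K m)].
Proof.
move=> bb; have l3 : (l + 3 < g + 3)%N by rewrite ltn_add2r.
pose piece_at p : comb := hub_vertex (Ordinal (ltn_ord b : b.+1 < g.+1)%N, Ordinal l3, p).
pose J m := piece_at (inr (m, true)); pose K m := piece_at (inr (m, false)).
have ne (u v : comb) : ((val u).1.1 != (val v).1.1) || ((val u).2 != (val v).2) -> u != v.
  by apply: contraTneq => ->; rewrite !eqxx.
have A_gt0 := side_gt0.
have inj (m m' : 'I_w) : eta m = eta m' -> m = m'.
  move=> e; have okm := eta_ok m; have okm' := eta_ok m'.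
  by apply: val_inj; case: (ltngtP m m') => // h; have := eta_mono h; lia.
exists (piece_at (inl (inl tt))), J, K; split.
- split=> m m' /(congr1 val); rewrite /= /hub /= => -[e1 e2 e3]; apply: inj; lia.
- move=> m m'; have okm := eta_ok m; have okm' := eta_ok m'.
  by apply: ne; rewrite /= /hub /=; lia.
- move=> m; have okm := eta_ok m; apply/and3P; split; apply/andP; split;
    try (by rewrite /= /hub /=; lia);
    by apply: ne; rewrite /= /hub /=; lia.
- move=> m z; have okm := eta_ok m; have zQ := ltn_ord z.
  have n0 : (0 < 8 * A)%N by rewrite muln_gt0.
  exists (hlane_vertex (b, l, m, z, Ordinal n0)).
    by rewrite inE; apply/codomP; exists (Ordinal n0).
  apply/andP; split; last by rewrite /= /hub /=; lia.
  by apply: ne; rewrite /= /hub /=; lia.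
- move=> m z; have okm := eta_ok m; have zQ := ltn_ord z.
  have n0 : (0 < 10 * A)%N by rewrite muln_gt0.
  exists (vlane_vertex (b', l, m, z, Ordinal n0)).
    by rewrite inE; apply/codomP; exists (Ordinal n0).
  apply/andP; split; last by rewrite /= /hub /= bb; lia.
  by apply: ne; rewrite /= /hub /= bb; lia.
Qed.

(** One level costs [chain_len] links, climbed from the last one, which touches [u], to link 0, and
    one more step to the node. *)
Lemma chain_near b l (l_lt : (l < g + 3)%N) (u : comb) :
    (forall r (r_lt : (r < chain_len)%N), r.+1 = chain_len ->
      touch (val u) (hub (b, Ordinal l_lt, inl (inr (Ordinal r_lt))))) ->
    within (l * chain_len.+1) root_vertex u ->
    within (l.+1 * chain_len.+1) root_vertex (hub_vertex (b, Ordinal l_lt, inl (inl tt))) /\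
    forall r : 'I_chain_len, within (l.+1 * chain_len.+1) root_vertex (hub_vertex (b, Ordinal l_lt, inl (inr r))).
Proof.
move=> ur near_u.
have down k : forall r (r_lt : (r < chain_len)%N), (r + k.+1)%N = chain_len ->
    within (l * chain_len.+1 + k.+1) root_vertex (hub_vertex (b, Ordinal l_lt, inl (inr (Ordinal r_lt)))).
  elim: k => [|k IH] r r_lt rk.
    by rewrite addn1; apply: touch_within near_u _; apply: ur; rewrite -rk addn1.
  have r1_lt : (r.+1 < chain_len)%N by lia.
  rewrite addnS; apply: touch_within (IH _ r1_lt _) _; first by rewrite -rk addSnnS.
  by rewrite /= /hub /=; lia.
have qr (r : 'I_chain_len) : within (l * chain_len.+1 + chain_len) root_vertex (hub_vertex (b, Ordinal l_lt, inl (inr r))).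
  have := down (chain_len - r.+1)%N r (ltn_ord r); rewrite (_ : Ordinal _ = r); last exact: val_inj.
  rewrite -subSn // subSS subnKC // 1?ltnW // => /(_ erefl); apply: within_le.
  by rewrite leq_add2l leq_subr.
have chain_len_gt0 : (0 < chain_len)%N by rewrite muln_gt0 expn_gt0 (ltnW kappa_gt1).
split=> [|r]; last by apply: within_le (qr r); rewrite mulSn addnC leq_add2r.
rewrite mulSn addSn addnC; apply: touch_within (qr (Ordinal chain_len_gt0)) _.
by rewrite /= /hub /=; lia.
Qed.

Lemma axis_near b l (l_lt : (l < g + 3)%N) :
    within (l.+1 * chain_len.+1) root_vertex (hub_vertex (b, Ordinal l_lt, inl (inl tt))) /\
    forall r : 'I_chain_len, within (l.+1 * chain_len.+1) root_vertex (hub_vertex (b, Ordinal l_lt, inl (inr r))).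
Proof.
elim: l l_lt => [|l IH] l_lt.
  apply: (chain_near (u := root_vertex)); last exact: within_refl.
  move=> r r_lt rs; have AE : A = (Q * r + Q)%N by rewrite /side -rs mulnS addnC.
  have bg : (b * A <= g * A)%N by rewrite leq_mul2r -ltnS ltn_ord orbT.
  by rewrite /= /hub /root_triple /extent /=; move: bg; rewrite AE; lia.
have l_lt' : (l < g + 3)%N by apply: ltnW.
apply: chain_near (IH l_lt').1 => r r_lt rs.
have AE : A = (Q * r + Q)%N by rewrite /side -rs mulnS addnC.
by rewrite /= /hub /= AE; lia.
Qed.

Lemma hub_near x : within ((g + 3) * chain_len.+1).+1 root_vertex (hub_vertex x).
Proof.
case: x => [[b [l l_lt]] p]; have [i_near q_near] := axis_near b l_lt.
have le : (l.+1 * chain_len.+1 <= (g + 3) * chain_len.+1)%N by rewrite leq_mul2r l_lt orbT.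
case: p => [[[]|r]|[m s]].
- by apply: within_le i_near; apply: leqW.
- by apply: within_le (q_near r); apply: leqW.
- have okm := eta_ok m; apply: touch_within (within_le le i_near) _.
  by case: s; rewrite /= /hub /=; lia.
Qed.

Lemma lane_near d N (f : 'I_N -> comb) :
  (forall i : 'I_N, val i = 0 -> within d root_vertex (f i)) ->
  (forall i j : 'I_N, j = i.+1 :> nat -> touch (val (f i)) (val (f j))) ->
  forall i : 'I_N, within (d + i) root_vertex (f i).
Proof.
move=> f0 fS [n n_lt] /=; elim: n n_lt => [|n IH] n_lt; first by rewrite addn0; apply: f0.
by rewrite addnS; apply: touch_within (IH (ltnW n_lt)) _; apply: fS.
Qed.

(** After the climb come one step to a wing, one to the first triangle of a lane, and less than
    [10 * A] along the lane. *)
Lemma comb_near v : within ((g + 3) * chain_len.+1 + 2 + 10 * A) root_vertex v.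
Proof.
case: v => v vin.
case: (vertsP vin) (vin) => [|x|x|x] {vin} vin.
- by rewrite (_ : SeqSub vin = root_vertex); [exact: within_refl|exact: val_inj].
- rewrite (_ : SeqSub vin = hub_vertex x); last exact: val_inj.
  by apply: within_le (hub_near x); lia.
- rewrite (_ : SeqSub vin = vlane_vertex x); last exact: val_inj.
  case: x vin => [[[[b l] m] z] n] _.
  have l3 : (l + 3 < g + 3)%N by rewrite ltn_add2r.
  have okm := eta_ok m; have zQ := ltn_ord z.
  apply: within_le (lane_near (d := ((g + 3) * chain_len.+1).+2) (f := fun n => vlane_vertex (b, l, m, z, n)) _ _ n).
  + by have := ltn_ord n; lia.
  + move=> i i0; apply: touch_within (hub_near (widen_ord (leqnSn g) b, Ordinal l3, inr (m, false))) _.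
    by rewrite /= /hub /= /vlane_triple i0 /=; lia.
  + by move=> i j ij; rewrite /= /vlane_triple ij /=; lia.
- rewrite (_ : SeqSub vin = hlane_vertex x); last exact: val_inj.
  case: x vin => [[[[b l] m] z] n] _.
  have l3 : (l + 3 < g + 3)%N by rewrite ltn_add2r.
  have okm := eta_ok m; have zQ := ltn_ord z.
  apply: within_le (lane_near (d := ((g + 3) * chain_len.+1).+2) (f := fun n => hlane_vertex (b, l, m, z, n)) _ _ n).
  + by have := ltn_ord n; lia.
  + move=> i i0; apply: touch_within (hub_near (Ordinal (ltn_ord b : b.+1 < g.+1)%N, Ordinal l3, inr (m, true))) _.
    by rewrite /= /hub /= /hlane_triple i0 /=; lia.
  + by move=> i j ij; rewrite /= /hlane_triple ij /=; lia.
Qed.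

Lemma comb_no_product t H n : (6 * t.+1 < w)%N ->
  (4 * t.+1 * (2 * ((g + 3) * chain_len.+1 + 2 + 10 * A)).+1 < g * Q)%N ->
  treewidth_at_most H t -> ~ is_subgraph comb (strong_product H (path_graph n)).
Proof.
move=> tw rQ.
have VH b l m z m' z' : vset b l m z :&: hset b l m' z' != set0 by apply: lanes_cross; rewrite eqxx.
have VHn b (l l' : 'I_g) m z m' z' : l' = l.+1 :> nat -> vset b l' m z :&: hset b l m' z' != set0.
  by move=> ll; apply: lanes_cross; rewrite ll eqxx orbT.
apply: (product_obstruction (x0 := root_vertex) comb_near (core := core vset hset)).
- move=> X [X1 X2]; apply: (core_neq0 VH vset_inj hset_inj w_gt0).
  by apply: leq_ltn_trans rQ; rewrite -[4%N]/(2 * 2)%N -!mulnA leq_mul2l /= mulnA.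
- exact: core_disjoint.
- move=> X [X1 X2].
  apply: (core_linked vset_conn hset_conn VH VHn vset_inj hset_inj comb_crossing w_gt0).
    by apply: leq_ltn_trans rQ; rewrite -[4%N]/(2 * 2)%N -!mulnA leq_mul2l /= mulnA.
  by move=> u; apply: leq_ltn_trans (X2 u) tw.
- exact: core_antitone.
Qed.

(** In undilated units, a wing has size [N * e], so its sides recede by [e], which pulls it out of
    the node. The sides of the node recede by [2 * A / N], more than the depth [e] to which the wing
    enters. *)
Lemma verts_inner N u v : kappa = N.+1 -> u \in verts -> v \in verts -> u != v ->
  ~~ touch (inner N v) (dilate N u).
Proof.
move=> kN uin vin uv; have := verts_size uin; have := verts_size vin.
have N0 : (0 < N)%N by lia.
case: (verts_disj uin vin uv).
- by move=> h s _; apply: inner_disj.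
- move=> [P [L [e [e' [-> vE eE e0 eA]]]]] _ _; subst e'; rewrite kN in eA.
  by case: vE => ->; rewrite /touch /=; nia.
- move=> [P [L [e [e' [-> uE eE e0 eA]]]]] _ _; subst e'; rewrite kN in eA.
  by case: uE => ->; rewrite /touch /=; nia.
Qed.

End Comb.

(* Imported only here: these files shadow the names of finset used above. *)
From mathcomp Require Import all_classical all_reals all_analysis.
From mathcomp Require Import measurable_realfun.
From mathcomp Require Import ring lra.
Import numFieldNormedType.Exports.
Local Open Scope classical_set_scope.
Local Open Scope ring_scope.

(** * Realization by homothets *)

Section Area.
Variable R : realType.
Local Notation leb := (@lebesgue_measure R).

Definition unscale (s w x : R) : R := (x - w) / s.

Lemma measurable_unscale (s w : R) :
  measurable_fun [set: measurableTypeR R] (unscale s w : _ -> measurableTypeR R).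
Proof.
rewrite /unscale; apply: (@measurable_funM _ _ R); last exact: measurable_cst.
by apply: (@measurable_funB _ _ R); [exact: measurable_id|exact: measurable_cst].
Qed.

(** The pushforward of the measure, divided by [s], agrees with Lebesgue measure on half-open
    intervals, hence everywhere. *)
Lemma lebesgue_unscale (s w : R) (A : set R) : 0 < s -> measurable A ->
  leb (unscale s w @^-1` A) = (s%:E * leb A)%E.
Proof.
move=> s0 mA.
have s1 : 0 <= s^-1 by rewrite invr_ge0 ltW.
pose g : measurableTypeR R -> measurableTypeR R := unscale s w.
have mg : measurable_fun setT g by exact: measurable_unscale.
pose nu0 : {measure set (measurableTypeR R) -> \bar R} :=
  measure_function_pushforward__canonical__measure_function_Measure leb mg.
pose nu : {measure set (measurableTypeR R) -> \bar R} := mscale (NngNum s1) nu0.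
have -> : leb A = nu A.
  apply: lebesgue_measure_unique => // _ [[a b]] _ <-.
  change (leb `]a, b]%classic = ((s^-1)%:E * leb (g @^-1` `]a, b]%classic))%E).
  have -> : g @^-1` `]a, b] = `]s * a + w, s * b + w]%classic.
    apply/seteqP; split => x /=; rewrite !in_itv/= /g /unscale ltr_pdivlMr// ler_pdivrMr//.
      by move=> /andP[h1 h2]; apply/andP; split; lra.
    by move=> /andP[h1 h2]; apply/andP; split; lra.
  rewrite !lebesgue_measure_itv /= !lte_fin ltrD2r ltr_pM2l//.
  case: ifP => _; last by rewrite mule0.
  rewrite -!EFinD -EFinM; congr EFin.
  rewrite (_ : s * b + w - (s * a + w) = s * (b - a)); last by ring.
  by rewrite mulrA mulVf ?gt_eqF// mul1r.
have -> : nu A = ((s^-1)%:E * leb (g @^-1` A))%E by [].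
rewrite muleA -EFinM mulfV ?gt_eqF// mul1e.
by [].
Qed.

Definition unscale2 (s : R) (w p : R * R) : R * R :=
  (unscale s w.1 p.1, unscale s w.2 p.2).

Local Notation plane := (measurableTypeR R * measurableTypeR R)%type.

Lemma measurable_unscale2 (s : R) (w : R * R) :
  measurable_fun [set: plane] (unscale2 s w : plane -> plane).
Proof.
apply/measurable_fun_pair => /=.
  exact: measurableT_comp (measurable_unscale s w.1) measurable_fst.
exact: measurableT_comp (measurable_unscale s w.2) measurable_snd.
Qed.

(** The same argument, by uniqueness of the product measure on rectangles. *)
Lemma area_unscale2 (s : R) (w : R * R) (A : set plane) : 0 < s ->
  measurable A ->
  area (unscale2 s w @^-1` A) = ((s ^+ 2)%:E * area A)%E.
Proof.
move=> s0 mA.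
have s1 : 0 <= (s ^+ 2)^-1 by rewrite invr_ge0 sqr_ge0.
pose g : plane -> plane := unscale2 s w.
have mg : measurable_fun setT g by exact: measurable_unscale2.
pose m2 : {measure set plane -> \bar R} := (leb \x leb)%E.
pose nu0 : {measure set plane -> \bar R} :=
  measure_function_pushforward__canonical__measure_function_Measure m2 mg.
pose nu : {measure set plane -> \bar R} := mscale (NngNum s1) nu0.
have nuE B : nu B = (((s ^+ 2)^-1)%:E * m2 (g @^-1` B))%E by [].
have /(_ mA) : measurable A -> (leb \x leb)%E A = nu A.
  apply: product_measure_unique => B C mB mC; rewrite nuE.
  have -> : g @^-1` (B `*` C) =
      (unscale s w.1 @^-1` B) `*` (unscale s w.2 @^-1` C) by [].
  have mg1 : measurable (unscale s w.1 @^-1` B : set (measurableTypeR R)).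
    by rewrite -[X in measurable X]setTI; exact: measurable_unscale.
  have mg2 : measurable (unscale s w.2 @^-1` C : set (measurableTypeR R)).
    by rewrite -[X in measurable X]setTI; exact: measurable_unscale.
  have -> : m2 ((unscale s w.1 @^-1` B) `*` (unscale s w.2 @^-1` C)) =
      (leb (unscale s w.1 @^-1` B) * leb (unscale s w.2 @^-1` C))%E.
    exact: product_measure1E.
  rewrite !lebesgue_unscale//.
  have -> : (s%:E * leb B * (s%:E * leb C) = (s ^+ 2)%:E * (leb B * leb C))%E.
    by rewrite muleACA -EFinM -expr2.
  rewrite muleA -EFinM mulVf ?mul1e//.
  by rewrite gt_eqF// exprn_gt0.
rewrite /area => ->.
rewrite nuE muleA -EFinM mulfV ?mul1e//.
by rewrite gt_eqF// exprn_gt0.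
Qed.

End Area.

Lemma scale_pairE (R : realType) (k : R) (p : R * R) : k *: p = (k * p.1, k * p.2).
Proof. by []. Qed.

Section Triangle.
Variables (R : realType) (T : set (R * R)).
Hypothesis hT : is_triangle T.

(** In the affine coordinates of [T] every triple is a homothet of (0, 0, 1), so its area follows by
    scaling that of [T], which is never computed. *)
Lemma triangle_chart : exists tri : R -> R -> R -> set (R * R),
  [/\ forall a b c a' b' c', a <= a' -> b <= b' -> c' <= c -> tri a' b' c' `<=` tri a b c,
      forall a b c, a + b < c -> homothetic_copy T (tri a b c),
      forall a b c, measurable (tri a b c : set (measurableTypeR R * measurableTypeR R)),
      forall a b c, a + b < c ->
        area (tri a b c) = (((c - a - b) ^+ 2)%:E * area T)%E &
      forall a b c a' b' c', tri a b c `&` tri a' b' c' !=set0 <->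
        Num.max a a' + Num.max b b' <= Num.min c c'].
Proof.
have [A [B [C [det TE]]]] := hT.
set d := (_ - _) in det.
(* Cramer's rule: [u] and [v] are the barycentric coordinates at [B] and [C], and [P] is the inverse
   chart. *)
pose u (p : R * R) := ((p.1 - A.1) * (C.2 - A.2) - (p.2 - A.2) * (C.1 - A.1)) / d.
pose v (p : R * R) := ((B.1 - A.1) * (p.2 - A.2) - (B.2 - A.2) * (p.1 - A.1)) / d.
pose P (x y : R) : R * R :=
  (A.1 + x * (B.1 - A.1) + y * (C.1 - A.1), A.2 + x * (B.2 - A.2) + y * (C.2 - A.2)).
have uP x y : u (P x y) = x by rewrite /u /P /= /d; field.
have vP x y : v (P x y) = y by rewrite /v /P /= /d; field.
have Puv p : P (u p) (v p) = p.
  by rewrite /P; case: p => p1 p2; congr pair; rewrite /u /v/= /d; field.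
pose tri (a b c : R) := [set p | [/\ a <= u p, b <= v p & u p + v p <= c]].
have TE0 : T = tri 0 0 1.
  rewrite TE; apply/seteqP; split => p /=.
    move=> [x [y [z [x0 y0 z0 xyz ->]]]].
    have -> : x *: A + y *: B + z *: C = P y z.
      have -> : x = 1 - y - z by lra.
      by rewrite !scale_pairE /P; congr pair; rewrite /=; ring.
    by split; rewrite ?uP ?vP //; lra.
  move=> [u0 v0 uv]; exists (1 - u p - v p), (u p), (v p); split=> //; [by lra|by ring|].
  by rewrite -[LHS]Puv /P !scale_pairE; congr pair; rewrite /=; ring.
have tri_scale a b c : a + b < c ->
    tri a b c = unscale2 (c - a - b) (P a b - (c - a - b) *: A) @^-1` T.
  move=> abc; have s0 : 0 < c - a - b by lra.
  have s1 : c - a - b != 0 by rewrite gt_eqF.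
  pose q p := unscale2 (c - a - b) (P a b - (c - a - b) *: A) p.
  have uq p : u p = a + (c - a - b) * u (q p).
    by rewrite /u /q /unscale2 /unscale /P !scale_pairE /= /d; field; rewrite s1 det.
  have vq p : v p = b + (c - a - b) * v (q p).
    by rewrite /v /q /unscale2 /unscale /P !scale_pairE /= /d; field; rewrite s1 det.
  have aux (U V : R) : 0 <= U -> 0 <= V -> U + V <= 1 ->
      [/\ a <= a + (c - a - b) * U, b <= b + (c - a - b) * V &
          a + (c - a - b) * U + (b + (c - a - b) * V) <= c].
    move=> U0 V0; rewrite -(ler_pM2l s0) => UV.
    by have := mulr_ge0 (ltW s0) U0; have := mulr_ge0 (ltW s0) V0; split; lra.
  have triE : tri a b c = [set p | tri 0 0 1 (q p)].
    apply/seteqP; split => p [h1 h2 h3].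
      rewrite uq in h1; rewrite vq in h2; rewrite uq vq in h3; split.
      - by rewrite -(pmulr_rge0 _ s0); lra.
      - by rewrite -(pmulr_rge0 _ s0); lra.
      - by rewrite -(ler_pM2l s0); lra.
    have [k1 k2 k3] := aux _ _ h1 h2 h3.
    by split; [rewrite uq; exact: k1|rewrite vq; exact: k2|rewrite uq vq; exact: k3].
  by rewrite triE TE0.
have mtri a b c : measurable (tri a b c : set (measurableTypeR R * measurableTypeR R)).
  have mu : measurable_fun [set: measurableTypeR R * measurableTypeR R] (u : _ -> measurableTypeR R).
    rewrite /u; apply: measurable_funM; last exact: measurable_cst.
    by apply: measurable_funB; apply: measurable_funM;
      (try exact: measurable_cst); apply: measurable_funB;
      (try exact: measurable_cst); [exact: measurable_fst|exact: measurable_snd].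
  have mv : measurable_fun [set: measurableTypeR R * measurableTypeR R] (v : _ -> measurableTypeR R).
    rewrite /v; apply: measurable_funM; last exact: measurable_cst.
    by apply: measurable_funB; apply: measurable_funM;
      (try exact: measurable_cst); apply: measurable_funB;
      (try exact: measurable_cst); [exact: measurable_snd|exact: measurable_fst].
  have muv := measurable_funD mu mv.
  have -> : tri a b c = u @^-1` `[a, +oo[ `&` v @^-1` `[b, +oo[ `&`
      (u \+ v) @^-1` `]-oo, c].
    apply/seteqP; split => p /=; rewrite !in_itv/= !andbT; first by move=> [].
    by move=> [[]].
  apply: measurableI; last by rewrite -[X in measurable X]setTI; exact: muv.
  by apply: measurableI; rewrite -[X in measurable X]setTI; [exact: mu|exact: mv].
exists tri; split => //.
- by move=> a b c a' b' c' aa bb cc p [h1 h2 h3]; split; [apply: le_trans h1|apply: le_trans h2|apply: le_trans cc].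
- move=> a b c abc; exists (c - a - b), (P a b - (c - a - b) *: A); split; first lra.
  have s1 : c - a - b != 0 by rewrite gt_eqF//; lra.
  rewrite tri_scale//; set s := c - a - b; set w := _ - _ *: A.
  apply/seteqP; split => p /=.
    move=> Tp; exists (unscale2 s w p) => //.
    by rewrite scale_pairE [RHS]surjective_pairing; congr pair;
      rewrite /= /unscale mulrC divfK// subrK.
  move=> [q Tq <-]; rewrite scale_pairE /unscale2 /unscale /= !addrK.
  by rewrite ![s * _]mulrC !mulfK// -surjective_pairing.
- move=> a b c abc; rewrite tri_scale// area_unscale2//; first lra.
  by rewrite TE0.
- move=> a b c a' b' c'; split.
    move=> [p [[h1 h2 h3] [h4 h5 h6]]].
    rewrite le_min; apply/andP; split.
      by apply: le_trans h3; apply: lerD; rewrite ge_max ?h1 ?h2.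
    by apply: le_trans h6; apply: lerD; rewrite ge_max ?h1 ?h2.
  (* The intersection is again such a triangle, and the witness is its lower left corner. *)
  rewrite le_min => /andP[h h']; exists (P (Num.max a a') (Num.max b b')).
  by split; split; rewrite ?uP ?vP// le_max lexx ?orbT.
Qed.
End Triangle.
Section Homothets.
Variables (R : realType) (T : set (R * R)) (alpha : R) (g w Q N : nat).
Hypothesis hT : is_triangle T.
Hypotheses (g_gt0 : (0 < g)%N) (w_gt0 : (0 < w)%N) (Q_gt0 : (0 < Q)%N) (N_gt3 : (3 < N)%N).
Hypothesis alphaN : alpha * N%:R ^+ 2 <= (N%:R - 3) ^+ 2.

(** The inner triangle of [v] meets no other triangle and has the fraction ((N - 3) / N)^2 of the
    area. *)
Lemma comb_homothets : free_homothet_graphs T alpha (comb g w Q N.+1).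
Proof.
have [tri [tri_sub tri_copy tri_meas tri_area tri_meets]] := triangle_chart hT.
pose emb (v : triple) := tri v.1.1%:~R v.1.2%:~R v.2%:~R.
pose F (v : comb g w Q N.+1) := emb (dilate N (val v)).
have N_gt0 : (0 < N)%N by apply: leq_trans N_gt3.
have kappa_gt1 : (1 < N.+1)%N by [].
have emb_meets u v : emb u `&` emb v !=set0 <-> touch u v.
  case: u v => [[a b] c] [[a' b'] c']; rewrite /emb tri_meets /touch /=.
  rewrite !(addr_maxl, addr_maxr) !ge_max !le_min -!intrD !ler_int.
  by split=> h; lia.
have size_v (v : comb g w Q N.+1) : let: (a, b, c) := val v in a + b < c.
  by have := verts_size g_gt0 w_gt0 Q_gt0 kappa_gt1 (valP v); case: (val v) => [[a b] c].
exists F; split.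
- move=> v; have := size_v v; rewrite /F; case: (val v) => [[a b] c] /= abc.
  by apply: tri_copy; rewrite -intrD ltr_int -mulrDr ltr_pM2l.
- move=> v.
  have inner_sub : emb (inner N (val v)) `<=` F v `\` \bigcup_(u in [set u | u != v]) F u.
    move=> p pv; split.
      move: pv; have := size_v v; rewrite /F /emb; case: (val v) => [[a b] c] /= abc.
      by apply: tri_sub; rewrite ler_int; lia.
    move=> [u /= uv pu].
    have := verts_inner g_gt0 w_gt0 Q_gt0 kappa_gt1 erefl (valP u) (valP v) uv.
    by move=> /negP; apply; apply/emb_meets; exists p.
  have mF u : measurable (F u : set (measurableTypeR R * measurableTypeR R)) by exact: tri_meas.
  have inner_le : (area (emb (inner N (val v))) <=
      area (F v `\` \bigcup_(u in [set u | u != v]) F u))%E.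
    rewrite /area; apply: le_measure => //; rewrite inE; first exact: tri_meas.
    by apply: measurableD => //; apply: fin_bigcup_measurable => //; apply: finite_finset.
  apply: le_trans inner_le; have := size_v v.
  rewrite /F /emb; case: (val v) => [[a b] c] /= abc.
  have N3 : 3 < N%:R :> R by rewrite ltr_nat.
  have s_gt0 : 0 < (c - a - b)%:~R :> R by rewrite ltr0z; lia.
  rewrite !tri_area; try (by rewrite -intrD ltr_int; nia).
  rewrite muleA -EFinM; apply: lee_wpmul2r; first exact: measure_ge0.
  rewrite lee_fin.
  have -> : (N%:Z * c)%:~R - (N%:Z * a)%:~R - (N%:Z * b)%:~R = N%:R * (c - a - b)%:~R :> R.
    by rewrite !intrM !intrB; ring.
  have -> : (N%:Z * c - (c - a - b))%:~R - (N%:Z * a + (c - a - b))%:~R - (N%:Z * b + (c - a - b))%:~R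
      = (N%:R - 3) * (c - a - b)%:~R :> R.
    by rewrite !(intrB, intrD, intrM); ring.
  by rewrite !exprMn mulrA ler_wpM2r // sqr_ge0.
- move=> u v; rewrite /= /comb_adj; split.
    by move=> /andP[-> uv]; split=> //; apply/emb_meets; rewrite touch_dilate.
  by move=> [-> /emb_meets]; rewrite touch_dilate.
Qed.
End Homothets.

Lemma core_fraction (R : realType) (alpha : R) : alpha < 1 ->
  exists N : nat, (3 < N)%N /\ alpha * N%:R ^+ 2 <= (N%:R - 3) ^+ 2.
Proof.
move=> a1; have d0 : 0 < 1 - alpha by lra.
(* Since (N - 3)^2 exceeds N^2 - 6 N, it suffices that N (1 - [alpha]) is at least 6; [.+4] also
   gives N > 3. *)
pose N := (Num.truncn (6 / (1 - alpha))).+4.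
exists N; split=> //.
have NE : 6 / (1 - alpha) <= N%:R.
  apply: le_trans (ltW (truncnS_gt _)) _.
  by rewrite ler_nat ltnS (leq_addl 3).
move: NE; rewrite ler_pdivrMr // => NE.
have N0 : 0 <= N%:R :> R by rewrite ler0n.
have := ler_wpM2l N0 NE; nra.
Qed.

Theorem corollary10 (R : realType) (T : set (R * R)) (alpha : R)
    (hT : is_triangle T) (halpha : 0 <= alpha < 1) :
  ~ admits_product_structure (free_homothet_graphs T alpha).
Proof.
case=> t prod.
have /andP[_ /core_fraction[N [N_gt3 alphaN]]] := halpha.
have kappa_gt1 : (1 < N.+1)%N by rewrite ltnS (ltn_trans _ N_gt3).
(* [w] exceeds the number of neighbours in a thin set, and [s] involves neither [g] nor [Q], so
   these can be chosen after it. *)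
pose w := (6 * t.+1).+1; pose s := chain_len w N.+1.
(* The comb has radius at most D + 10 * Q * s; the second summand is absorbed
   by the choice of g, the first one by that of Q. *)
pose g := (80 * t.+1 * s).+1; pose D := ((g + 3) * s.+1 + 2)%N.
pose Q := (4 * t.+1 * (2 * D).+1).+1.
have [H [n [tw sub]]] := prod (comb g w Q N.+1)
  (comb_homothets (w := w) (Q := Q) hT (ltn0Sn _ : (0 < g)%N) (ltn0Sn _) (ltn0Sn _) N_gt3 alphaN).
apply: (comb_no_product (w := w) (Q := Q) (g := g) (ltn0Sn _) (ltn0Sn _) (ltn0Sn _) kappa_gt1 _ _ tw sub) => //.
rewrite -/s -/D /side -/s.
have -> : (4 * t.+1 * (2 * (D + 10 * (Q * s))).+1 = 4 * t.+1 * (2 * D).+1 + 80 * t.+1 * s * Q)%N by ring.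
by rewrite [ltnRHS]mulSn ltn_add2r.
Qed.
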